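(* Let $f$ be a nonnegative continuous function on $E$. Let $\{\mathbb P_\alpha\}$ be a family of Borel probability measures on $\mathrm{Conf}(E)$ such that (1) $f\in L_1(E,\xi\mathbb P_\alpha)$ for all $\alpha$ and $\sup_\alpha\int_Ef\,d\xi\mathbb P_\alpha<+\infty$; (2) for any $\varepsilon>0$ there exists a compact set $B_\varepsilon\subset E$ such that $\sup_\alpha\int_{E\setminus B_\varepsilon}f\,d\xi\mathbb P_\alpha<\varepsilon$. Then the family $(\sigma_f)_*\mathbb P_\alpha$ is tight in $\mathfrak M_{\mathrm{fin}}(\mathfrak M_{\mathrm{fin}}(E))$.
   Context: $E$ is a locally compact complete separable metric space in which bounded sets have compact closure. $\mathrm{Conf}(E)$ is the space of configurations on $E$ (collections of points, without regard to order, with finitely many points in every bounded set), with the topology induced by identifying $X$ with the Radon measure $\sum_{x\in X}\delta_x$ and using the vague topology. For a topological space $S$, $\mathfrak M_{\mathrm{fin}}(S)$ is the space of finite Borel measures on $S$ with the weak topology (convergence of integrals of bounded continuous functions); in particular $\mathfrak M_{\mathrm{fin}}(\mathfrak M_{\mathrm{fin}}(E))$ is the space of finite Borel measures on the space of finite Borel measures on $E$. The intensity $\xi\mathbb P$ of a probability measure $\mathbb P$ on $\mathrm{Conf}(E)$ is the measure on $E$ given by $\xi\mathbb P(B)=\int\#_B(X)\,d\mathbb P(X)$ for bounded Borel $B$, where $\#_B(X)$ is the number of particles of $X$ in $B$. Set $\mathrm{Conf}_f(E)=\{X:\sum_{x\in X}f(x)<\infty\}$ and $\sigma_f:\mathrm{Conf}_f(E)\to\mathfrak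 M_{\mathrm{fin}}(E)$, $\sigma_f(X)=\sum_{x\in X}f(x)\delta_x$. If $f\in L_1(E,\xi\mathbb P)$, then $\mathbb P(\mathrm{Conf}_f(E))=1$, so $(\sigma_f)_*\mathbb P$ is a well-defined Borel probability measure on $\mathfrak M_{\mathrm{fin}}(E)$. *)

(* Defs.v *)
From HB Require Import structures.
From mathcomp Require Import all_boot all_order all_algebra.
From mathcomp Require Import all_classical all_reals all_analysis.

Set Implicit Arguments.
Unset Strict Implicit.
Unset Printing Implicit Defensive.
Import Order.TTheory GRing.Theory Num.Theory.
Import numFieldNormedType.Exports.
Local Open Scope classical_set_scope.
Local Open Scope ring_scope.

#[short(type="completeMetricType")]
HB.structure Definition CompleteMetric (K : numDomainType) :=
  {T of Complete T & Metric K T}.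

Section metric_notions.
Context {R : realType} {E : completeMetricType R}.

Definition separable := exists2 D : set E, countable D & dense D.

Definition mbounded (A : set E) := exists (x : E) (r : R), A `<=` ball x r.

Definition bounded_precompact :=
  forall A : set E, mbounded A -> compact (closure A).

End metric_notions.
Arguments separable {R} E.
Arguments bounded_precompact {R} E.

Definition borel (S : ptopologicalType) := g_sigma_algebraType (@open S).

HB.instance Definition _ (S : ptopologicalType) := Measurable.on (borel S).

Section atomic_measure.
Context d (T : measurableType d) (R : realType) (w : T -> R).
Hypothesis w0 : forall x, 0 <= w x.
Local Open Scope ereal_scope.

(* The measure \sum_x w(x) \delta_x; the unused proof argument lets the measure
   instance be inferred. *)
Definition atomic of (forall x, (0 <= w x)%R) := fun B : set T =>
  \esum_(x in B) (w x)%:E.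

Local Notation mu := (atomic w0).

Let atomic0 : mu set0 = 0.
Proof. exact: esum_set0. Qed.

Let atomic_ge0 B : 0 <= mu B.
Proof. by apply: esum_ge0 => x _; rewrite lee_fin. Qed.

Let atomic_sigma_additive : semi_sigma_additive mu.
Proof.
move=> F mF tF mUF; rewrite /atomic.
have -> : \esum_(x in \bigcup_n F n) (w x)%:E =
    \sum_(n <oo) \esum_(x in F n) (w x)%:E.
  by apply: nneseries_sum_bigcup => // x; rewrite lee_fin.
apply: is_cvg_nneseries => n _ _.
by apply: esum_ge0 => x _; rewrite lee_fin.
Qed.

HB.instance Definition _ := isMeasure.Build _ _ _ mu
  atomic0 atomic_ge0 atomic_sigma_additive.

End atomic_measure.
Arguments atomic {d T R w}.

Section finite_borel_measures.
Context (R : realType) (S : ptopologicalType).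

(* A library measure is a function on all subsets; the condition mfin_out
   makes two finite measures equal as soon as they agree on Borel sets. *)
Record Mfin := MkMfin {
  mfin :> {finite_measure set (borel S) -> \bar R} ;
  mfin_out : forall A : set (borel S), ~ measurable A -> mfin A = 0%E }.

HB.instance Definition _ := gen_eqMixin Mfin.
HB.instance Definition _ := gen_choiceMixin Mfin.

Section of_measure.
Variable m : {measure set (borel S) -> \bar R}.
Hypothesis mfinite : (m setT < +oo)%E.
Local Open Scope ereal_scope.

Definition borel_part of (m setT < +oo) := fun A : set (borel S) =>
  if `[< measurable A >] then m A else 0.

Local Notation mu := (borel_part mfinite).

Let muE A : measurable A -> mu A = m A.
Proof. by move=> mA; rewrite /borel_part asboolT. Qed.

Let mu0 : mu set0 = 0.
Proof. by rewrite muE. Qed.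

Let mu_ge0 A : 0 <= mu A.
Proof. by rewrite /borel_part; case: ifP. Qed.

Let mu_sigma_additive : semi_sigma_additive mu.
Proof.
move=> F mF tF mUF; rewrite muE//.
under eq_fun do under eq_bigr do rewrite muE//.
exact: measure_semi_sigma_additive.
Qed.

HB.instance Definition _ := isMeasure.Build _ _ _ mu
  mu0 mu_ge0 mu_sigma_additive.

Let mu_fin : fin_num_fun mu.
Proof.
move=> A mA; rewrite muE// ge0_fin_numE//.
by apply: le_lt_trans mfinite; apply: le_measure; rewrite ?inE.
Qed.

HB.instance Definition _ := Measure_isFinite.Build _ _ _ mu mu_fin.

Let mu_out A : ~ measurable A -> mu A = 0.
Proof. by move=> nmA; rewrite /borel_part asboolF. Qed.

Definition mfin_of : Mfin := MkMfin mu_out.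

Lemma mfin_ofE A : measurable A -> mfin_of A = m A.
Proof. exact: muE. Qed.

End of_measure.

Let mzero_lt : ((mzero : {measure set (borel S) -> \bar R}) setT < +oo)%E.
Proof. by rewrite /mzero ltry. Qed.

Definition mfin0 : Mfin := mfin_of mzero_lt.

HB.instance Definition _ := isPointed.Build Mfin mfin0.

Lemma mfin_eq (mu nu : Mfin) :
  (forall A, measurable A -> mu A = nu A) -> mu = nu.
Proof.
move=> munu; have {}munu : (mu : set _ -> \bar R) = nu.
  apply/funext => A; have [/munu//|nA] := pselect (measurable A).
  by rewrite !mfin_out.
case: mu nu munu => [[mu cmu] mu_out] [[nu cnu] nu_out]/= munu.
subst nu; have cE : cmu = cnu.
  clear mu_out nu_out.
  case: cmu => [[a1 a2] [b] [c] [d] [e]]; case: cnu => [[a1' a2'] [b'] [c'] [d'] [e']].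
  by rewrite (Prop_irrelevance a1 a1') (Prop_irrelevance a2 a2')
    (Prop_irrelevance b b') (Prop_irrelevance c c') (Prop_irrelevance d d')
    (Prop_irrelevance e e').
by move: nu_out; rewrite -cE => nu_out; congr MkMfin; exact: Prop_irrelevance.
Qed.

Definition bounded_continuous :=
  {phi : S -> R | continuous phi /\ [bounded phi x | x in [set: S]]}.

HB.instance Definition _ := gen_eqMixin bounded_continuous.
HB.instance Definition _ := gen_choiceMixin bounded_continuous.

Definition weak_eval (mu : Mfin) :
    prod_topology (fun _ : bounded_continuous => R) :=
  fun phi => \int[mu]_x (sval phi x).

(* The weak topology: the coarsest one making mu |-> \int phi dmu continuous
   for every bounded continuous phi. *)
HB.instance Definition _ := Topological.copy Mfin (initial_topology weak_eval).

End finite_borel_measures.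

(* In a Hausdorff space closedness of K is automatic; it is demanded so that
   ~` K is Borel in any case. *)
Definition tight (R : realType) (S : ptopologicalType) (I : Type)
    (nu : I -> Mfin R S) :=
  (ereal_sup [set nu i setT | i in [set: I]] < +oo)%E /\
  forall e : R, 0 < e -> exists K : set S,
    [/\ compact K, closed K &
        (ereal_sup [set nu i (~` K) | i in [set: I]] < e%:E)%E].

Section configurations.
Context {R : realType} (E : completeMetricType R).

(* A configuration is a multiset, given by the multiplicities of its
   particles. *)
Record Conf := MkConf {
  mult :> E -> nat ;
  mult_finite : forall B : set E, mbounded B ->
    finite_set (B `&` [set x | mult x != 0%N]) }.

HB.instance Definition _ := gen_eqMixin Conf.
HB.instance Definition _ := gen_choiceMixin Conf.

Let emptyconf_finite (B : set E) : mbounded B ->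
  finite_set (B `&` [set x : E | (fun=> 0%N) x != 0%N]).
Proof. by move=> _; apply: (sub_finite_set _ (finite_set0 E)) => x []. Qed.

HB.instance Definition _ := isPointed.Build Conf (MkConf emptyconf_finite).

Let mult_ge0 (X : Conf) (x : borel E) : 0 <= (X x)%:R :> R.
Proof. exact: ler0n. Qed.

(* The Radon measure \sum_(x in X) \delta_x; conf_measure X B is the number of
   particles of X in B. *)
Definition conf_measure (X : Conf) : {measure set (borel E) -> \bar R} :=
  atomic (mult_ge0 X).

Definition compactly_supported :=
  {phi : E -> R | continuous phi /\ compact (closure [set x | phi x != 0])}.

HB.instance Definition _ := gen_eqMixin compactly_supported.
HB.instance Definition _ := gen_choiceMixin compactly_supported.

Definition vague_eval (X : Conf) :
    prod_topology (fun _ : compactly_supported => R) :=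
  fun phi => \int[conf_measure X]_x (sval phi x).

HB.instance Definition _ := Topological.copy Conf (initial_topology vague_eval).

(* For bounded B this is the defining formula; for other B it is the only
   countably additive extension, with value +oo allowed. *)
Definition intensity (P : probability (borel Conf) R) : set (borel E) -> \bar R
  := fun B => (\int[P]_X conf_measure X B)%E.

Section sigma_map.
Variable f : E -> R.

Definition Conf_f : set Conf :=
  [set X | (\esum_(x in [set: E]) ((X x)%:R * f x)%:E < +oo)%E].

Hypothesis f0 : forall x, 0 <= f x.

Let weight_ge0 (X : Conf) (x : borel E) : 0 <= (X x)%:R * f x.
Proof. by rewrite mulr_ge0. Qed.

(* \sigma_f, extended by the zero measure outside Conf_f. *)
Definition sigma_map (X : Conf) : Mfin R E :=
  match pselect (Conf_f X) with
  | left XCf => @mfin_of R E (atomic (weight_ge0 X)) XCf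
  | right _ => mfin0 R E
  end.

End sigma_map.

End configurations.
Arguments Conf {R} E.
Arguments Conf_f {R E} f.
Arguments sigma_map {R E f} f0 X.

(* Q is the image of P under a map g defined P-almost everywhere, with
   domain D. *)
Definition is_pushforward (R : realType) (S S' : ptopologicalType)
    (P : probability (borel S) R) (D : set S) (g : S -> S') (Q : Mfin R S') :=
  [/\ measurable (D : set (borel S)), P D = 1%E,
      measurable_fun (D : set (borel S)) (g : borel S -> borel S') &
      forall A : set (borel S'), measurable A -> Q A = P (D `&` g @^-1` A)].

(* Main.v *)
Require Import Defs.
From HB Require Import structures.
From mathcomp Require Import all_boot all_order all_algebra.
From mathcomp Require Import all_classical all_reals all_analysis.
From mathcomp Require Import measurable_realfun lra.
Import Order.TTheory GRing.Theory Num.Theory.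
Import numFieldNormedType.Exports.
Local Open Scope classical_set_scope.
Local Open Scope ring_scope.

(* By Campbell's formula the expectation of sigma_f(X)(A) is the integral of f
   over A with respect to the intensity.  Hence, by Markov's inequality, with
   probability at least 1 - e the random measure sigma_f(X) has mass at most C
   and gives mass at most 1/(n+1) to the complement of B_n for all n, where C
   and the compact sets B_n do not depend on the law.  The set of all measures
   with these two properties is compact (the direct half of Prokhorov's theorem
   for finite measures): along an ultrafilter the masses of the compact sets
   converge to a content, this content extends to a Borel measure by
   Caratheodory's construction, and the ultrafilter converges to that measure
   by the portmanteau criterion.  The same criterion yields a countable base of
   the weak topology, which reduces the Borel measurability of sigma_f to that
   of X |-> sigma_f(X)(U) for open sets U. *)

Set Implicit Arguments.
Unset Strict Implicit.
Unset Printing Implicit Defensive.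

(** * Distance to a set *)

Section distance_to_set.
Context {R : realType} {T : metricType R}.
Implicit Types (A : set T) (x y : T).

(* Truncated at 1, so that the empty set is at distance 1 instead of inf set0 = 0. *)
Definition dset A x : R := inf ([set mdist x a | a in A] `|` [set 1]).

Let dset_lb A x : has_lbound ([set mdist x a | a in A] `|` [set 1]).
Proof. by exists 0 => _ [[a _ <-]|->]; rewrite ?mdist_ge0. Qed.

Let dset_n0 A x : ([set mdist x a | a in A] `|` [set 1]) !=set0.
Proof. by exists 1; right. Qed.

Lemma dset_ge0 A x : 0 <= dset A x.
Proof.
by apply: lb_le_inf; [exact: dset_n0|move=> _ [[a _ <-]|->]; rewrite ?mdist_ge0].
Qed.

Lemma dset_le1 A x : dset A x <= 1.
Proof. by apply: (ge_inf (dset_lb A x)); right. Qed.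

Lemma dset_le_mdist A x a : A a -> dset A x <= mdist x a.
Proof. by move=> Aa; apply: (ge_inf (dset_lb A x)); left; exists a. Qed.

Lemma dset_triangle A x y : dset A x <= mdist x y + dset A y.
Proof.
rewrite -lerBlDl; apply: lb_le_inf => [|_ [[a Aa <-]|->]]; first exact: dset_n0.
- by rewrite lerBlDl (le_trans (dset_le_mdist x Aa))// metric_triangle.
- by rewrite lerBlDl (le_trans (dset_le1 A x))// lerDr mdist_ge0.
Qed.

Lemma dset_continuous A : continuous (dset A).
Proof.
move=> x; apply/cvgrPdist_lt => e e0.
apply: filterS (nbhsx_ballx x e e0) => y; rewrite ballEmdist/= => xye.
rewrite (le_lt_trans _ xye)// ler_norml lerBlDr dset_triangle andbT.
by rewrite lerNl opprB lerBlDr metric_sym dset_triangle.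
Qed.

Lemma dset_eq0 A x : A x -> dset A x = 0.
Proof.
move=> Ax; apply/eqP; rewrite eq_le dset_ge0 andbT.
by rewrite (le_trans (dset_le_mdist x Ax))// mdistxx.
Qed.

Lemma dset_gt0 A x : closed A -> ~ A x -> 0 < dset A x.
Proof.
move=> cA nAx; have [e /= e0 eA] : nbhs_ball x (~` A).
  by rewrite nbhs_ballE; apply: open_nbhs_nbhs; split=> //; exact: closed_openC.
apply: (@lt_le_trans _ _ (Num.min e 1)); first by rewrite lt_min e0/=.
apply: lb_le_inf => [|_ [[a Aa <-]|->]]; first exact: dset_n0.
- rewrite ge_min leNgt; apply/orP; left; apply/negP => xae.
  by apply: (eA a) => //; rewrite ballEmdist.
- by rewrite ge_min lexx orbT.
Qed.

(** Continuous substitutes for the indicator of an open [U]: they vanish off [U] and increase to it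
    with [n], because the distance to the closed complement is positive on [U]. *)
Definition tent (U : set T) (n : nat) (x : T) : R :=
  Num.min 1 (n%:R * dset (~` U) x).

Lemma tent_continuous U n : continuous (tent U n).
Proof.
move=> x; apply: (@continuous_min R T (fun=> 1)); first exact: cvg_cst.
by apply: cvgMl_tmp; exact: dset_continuous.
Qed.

Lemma tent_ge0 U n x : 0 <= tent U n x.
Proof. by rewrite le_min ler01 mulr_ge0// dset_ge0. Qed.

Lemma tent_le1 U n x : tent U n x <= 1.
Proof. by rewrite ge_min lexx. Qed.

Lemma tent_out U n x : ~ U x -> tent U n x = 0.
Proof. by move=> nUx; rewrite /tent dset_eq0// mulr0 min_r. Qed.

Lemma tent_le_indic U n x : tent U n x <= \1_U x.
Proof.
rewrite indicE; have [|] := boolP (x \in U); first by rewrite tent_le1.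
by rewrite notin_setE => /tent_out ->.
Qed.

Lemma tent_nd U x : {homo tent U ^~ x : m n / (m <= n)%N >-> m <= n}.
Proof.
move=> m n mn; rewrite /tent le_min !ge_min lexx/= ler_wpM2r ?orbT//.
  exact: dset_ge0.
by rewrite ler_nat.
Qed.

Lemma cvg_tent U x : open U -> tent U n x @[n --> \oo] --> (\1_U x : R).
Proof.
move=> oU; have [Ux|nUx] := pselect (U x); last first.
  rewrite indicE memNset//; under eq_fun do rewrite tent_out//.
  exact: cvg_cst.
have d0 : 0 < dset (~` U) x.
  by apply: dset_gt0 => //; exact: open_closedC.
rewrite indicE mem_set//; apply: cvg_near_cst; near=> n.
rewrite /tent; apply/min_idPl; rewrite -ler_pdivrMr// mul1r ltW//.
near: n; exact: nbhs_infty_gtr.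
Unshelve. all: by end_near. Qed.

End distance_to_set.

(** * Approximation by layers *)

Lemma open_borel {S : ptopologicalType} (U : set S) :
  open U -> measurable (U : set (borel S)).
Proof. exact: sub_sigma_algebra. Qed.

Lemma closed_borel {S : ptopologicalType} (A : set S) :
  closed A -> measurable (A : set (borel S)).
Proof.
move=> cA; rewrite -[A]setCK; apply: measurableC.
by apply: open_borel; exact: closed_openC.
Qed.

Lemma continuous_borel {R : realType} {S : ptopologicalType} (g : S -> R) :
  continuous g -> measurable_fun setT (g : borel S -> R).
Proof.
move=> cg; apply: (measurability _ (RGenOInfty.measurableE R)).
move=> /= _ [_ [a ->]] <-; apply: measurableI => //.
by apply: open_borel; move/continuousP : cg; apply; exact: rray_open.
Qed.

Section layers.
Context {R : realType}.

(** The sum counts the integers from 1 to [n] strictly below [y]; for [y > 0] this is the ceiling of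
    [y] minus 1. *)
Lemma count_layers (n : nat) (y : R) : 0 <= y -> y <= n%:R ->
  \sum_(k < n) (k.+1%:R < y)%R%:R <= y <= \sum_(k < n) (k.+1%:R < y)%R%:R + 1.
Proof.
move=> y0 yn; set c := fun n : nat => \sum_(k < n) ((k.+1%:R < y)%R%:R : R).
(* Both bounds are truncated at the number [m] of layers, so that they pass through an induction on
   [m]; at [m = n >= y] they give back the claim. *)
suff H m : c m <= Num.min m%:R y /\ Num.min y m.+1%:R <= c m + 1.
  have [+ _] := H n; rewrite le_min => /andP[_ ->]/=.
  have [_] := H n; apply: le_trans.
  by rewrite le_min lexx (le_trans yn)// ler_nat.
elim: m => [|m [IH1 IH2]].
  rewrite /c big_ord0 le_min lexx y0; split => //.
  by rewrite add0r ge_min lexx orbT.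
have cS : c m.+1 = c m + (m.+1%:R < y)%R%:R by rewrite /c big_ord_recr.
move: IH1 IH2; rewrite cS !le_min => /andP[cm cy]; rewrite !ge_min.
have [my|ym] := ltP (m.+1%:R) y => /= IH.
- have : m.+1%:R <= c m + 1.
    by move: IH => /orP[/(lt_le_trans my)/ltW|].
  have := my.
  rewrite -!natr1 => *; split; first by apply/andP; split; lra.
  by apply/orP; right; lra.
- rewrite addr0 cy (le_trans cm) ?ler_nat//; split => //.
  by move: IH => /orP[->//|/(le_trans ym) ->].
Qed.

Context d (T : measurableType d).

(** This is [count_layers] at [n * h x], integrated over [x]: the integral of [h] is read off from
    the masses of [n] superlevel sets, with error at most the total mass over [n]. *)
Lemma layer_integral (mu : {measure set T -> \bar R}) (h : T -> R) (n : nat) :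
  measurable_fun setT h -> (forall x, 0 <= h x <= 1) ->
  (\sum_(k < n) mu [set x | (k.+1%:R < n%:R * h x)%R]
     <= n%:R%:E * \int[mu]_x (h x)%:E
     <= \sum_(k < n) mu [set x | (k.+1%:R < n%:R * h x)%R] + mu setT)%E.
Proof.
move=> mh h01; pose A (k : 'I_n) := [set x | k.+1%:R < n%:R * h x].
have mA k : measurable (A k).
  have -> : A k = setT `&` (fun x => n%:R * h x) @^-1` `]k.+1%:R, +oo[.
    by rewrite setTI; apply/seteqP; split => x /=; rewrite in_itv/= andbT.
  by apply: measurable_funM => //; exact: measurable_itv.
have m1A k : measurable_fun setT (fun x => (\1_(A k) x)%:E : \bar R).
  by apply/measurable_EFinP; exact: measurable_indic.
have layers x := @count_layers n (n%:R * h x).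
have h0 x : 0 <= h x by have /andP[] := h01 x.
have {}layers x : \sum_(k < n) (\1_(A k) x : R) <= n%:R * h x
    <= \sum_(k < n) (\1_(A k) x : R) + 1.
  have -> : \sum_(k < n) (\1_(A k) x : R) =
      \sum_(k < n) ((k.+1%:R < n%:R * h x)%R%:R : R).
    by apply: eq_bigr => k _; rewrite indicE mem_setE.
  apply: layers; first by rewrite mulr_ge0.
  by rewrite -[leRHS]mulr1 ler_wpM2l//; have /andP[] := h01 x.
have -> : (\sum_(k < n) mu (A k) =
    \int[mu]_x \sum_(k < n) (\1_(A k) x)%:E)%E.
  rewrite ge0_integral_sum//.
  by apply: eq_bigr => k _; rewrite integral_indic// setIT.
rewrite -ge0_integralZl//; [|exact/measurable_EFinP|by move=> x _; rewrite lee_fin].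
have mS : measurable_fun setT (fun x => \sum_(k < n) (\1_(A k) x)%:E : \bar R)%E.
  exact: emeasurable_sum.
apply/andP; split.
- apply: ge0_le_integral => //.
  + by move=> x _; apply: sume_ge0 => k _; rewrite lee_fin.
  + by apply: measurable_funeM; exact/measurable_EFinP.
  + by move=> x _; rewrite sumEFin -EFinM lee_fin; have /andP[] := layers x.
- rewrite -[X in (_ <= _ + X)%E]mul1e -(integral_cst mu measurableT)//.
  rewrite -ge0_integralD//; last first.
    by move=> x _; apply: sume_ge0 => k _; rewrite lee_fin.
  apply: ge0_le_integral => //.
  + by move=> x _; rewrite -EFinM lee_fin mulr_ge0.
  + by apply: measurable_funeM; exact/measurable_EFinP.
  + exact: emeasurable_funD.
  + by move=> x _; rewrite sumEFin -EFinM -EFinD lee_fin; have /andP[] := layers x.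
Qed.

End layers.

(** * The weak topology *)

Lemma cvg_initial {S : pointedType} {T : topologicalType} (g : S -> T)
    (F : set_system S) (s : S) : Filter F ->
  g @ F --> g s -> F --> (s : initial_topology g).
Proof.
move=> FF gF A /= [_ [[B oB <-] Bgs BA]].
by apply: filterS BA _; apply: gF; exact: open_nbhs_nbhs.
Qed.

Lemma cvg_prod_topology {I : Type} {K : I -> topologicalType}
    (F : set_system (prod_topology K)) (t : prod_topology K) : Filter F ->
  (forall i, s i @[s --> F] --> t i) -> F --> t.
Proof.
move=> FF tF; apply/cvg_sup => i A /= [_ [[B oB <-] Bti BA]].
by apply: filterS BA _; apply: tF; exact: open_nbhs_nbhs.
Qed.

Section weak_topology.
Context {R : realType} {S : ptopologicalType}.

Lemma mfin_cvg_eval (F : set_system (Mfin R S)) (mu : Mfin R S) : Filter F ->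
  (forall phi : bounded_continuous R S,
    (fun nu : Mfin R S => \int[nu]_x (sval phi x)) @ F --> \int[mu]_x (sval phi x)) ->
  F --> mu.
Proof.
move=> FF Fphi; apply: (@cvg_initial _ _ (@weak_eval R S)).
exact: cvg_prod_topology.
Qed.

Lemma mfin_eval_continuous (phi : S -> R) : continuous phi ->
  [bounded phi x | x in [set: S]] ->
  continuous (fun nu : Mfin R S => \int[nu]_x (phi x)).
Proof.
move=> cphi bphi; pose p : bounded_continuous R S := exist _ phi (conj cphi bphi).
move=> mu; apply: (@continuous_comp _ _ _ (@weak_eval R S) (@proj _ (fun=> R) p)).
  exact: initial_continuous.
exact: proj_continuous.
Qed.

Lemma bounded_continuous_integrable (mu : Mfin R S) (phi : S -> R) :
  continuous phi -> [bounded phi x | x in [set: S]] ->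
  mu.-integrable setT (EFin \o (phi : borel S -> R)).
Proof.
move=> cphi bphi; apply: measurable_bounded_integrable => //.
- by rewrite -ge0_fin_numE// fin_num_measure.
- exact: continuous_borel.
Qed.

End weak_topology.

Lemma mfin_fin_num {R : realType} {S : ptopologicalType} (mu : Mfin R S)
    (A : set (borel S)) : mu A \is a fin_num.
Proof.
have [mA|/mfin_out ->//] := pselect (measurable A).
exact: fin_num_measure.
Qed.

Lemma unit_bounded {R : realType} {T : Type} (h : T -> R) :
  (forall x, 0 <= h x <= 1) -> [bounded h x | x in [set: T]].
Proof.
move=> h01; exists 1; split => [|M M1 x _]; first exact: num_real.
have /andP[h0 h1] := h01 x.
by rewrite /= ger0_norm// (le_trans h1)// ltW.
Qed.

(** * Lower semicontinuity of integrals and the portmanteau criterion *)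

Section weak_limits.
Context {R : realType} {S : ptopologicalType}.

Lemma continuous_superlevel_open (h : S -> R) (a : R) :
  continuous h -> open [set x | a < h x].
Proof.
move=> ch; rewrite (_ : mkset _ = h @^-1` [set y | a < y])//.
by move/continuousP : ch; apply; exact: open_gt.
Qed.

Let mscalel_continuous (h : S -> R) (a : R) :
  continuous h -> continuous (fun x => a * h x).
Proof. by move=> ch x; apply: cvgMl_tmp; exact: ch. Qed.

Lemma layer_Rintegral (mu : Mfin R S) (h : S -> R) (n : nat) :
  continuous h -> (forall x, 0 <= h x <= 1) ->
  \sum_(k < n) fine (mu [set x | k.+1%:R < n%:R * h x])
     <= n%:R * \int[mu]_x (h x)
     <= \sum_(k < n) fine (mu [set x | k.+1%:R < n%:R * h x]) + fine (mu setT).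
Proof.
move=> ch h01; rewrite -!lee_fin EFinD EFinM -!sumEFin.
under eq_bigr do rewrite fineK ?mfin_fin_num//.
rewrite (fineK (mfin_fin_num mu setT)) /Rintegral fineK; last first.
  apply: integrable_fin_num => //.
  by apply: bounded_continuous_integrable => //; exact: unit_bounded.
by apply: layer_integral => //; exact: continuous_borel.
Qed.

(** Up to an error [M / n], the integral of [h] is the average of the masses of [n] open superlevel
    sets; there are finitely many of these, and along [F] each mass drops only slightly. *)
Lemma lsc_integral (F : set_system (Mfin R S)) (mu : Mfin R S) (h : S -> R) :
  Filter F ->
  (forall (U : set S) (q : R), open U -> (q%:E < mu U)%E ->
    \forall nu \near F, (q%:E < (nu : Mfin R S) U)%E) ->
  continuous h -> (forall x, 0 <= h x <= 1) ->
  forall q, q < \int[mu]_x (h x) ->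
  \forall nu \near F, q < \int[nu : Mfin R S]_x (h x).
Proof.
move=> FF Fopen ch h01 q qh; set M := fine (mu setT).
have M0 : 0 <= M by rewrite fine_ge0.
have d0 : 0 < \int[mu]_x (h x) - q by rewrite subr_gt0.
(* The margin times [n] has to exceed [M], the layer error for [mu], plus 1, the total of the drops
   [1 / n] allowed on the [n] layers. *)
have [n nP] : exists n : nat, (M + 1) / (\int[mu]_x (h x) - q) < n%:R.
  exact: filter_ex (nbhs_infty_gtr _).
have n0 : 0 < n%:R :> R by rewrite (le_lt_trans _ nP)// divr_ge0// ?ltW// ltr_wpDl.
pose U (k : 'I_n) := [set x | k.+1%:R < n%:R * h x].
have oU k : open (U k) by apply/continuous_superlevel_open/mscalel_continuous.
have FU : \forall nu \near F, forall k : 'I_n,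
    ((fine (mu (U k)) - n%:R^-1)%:E < (nu : Mfin R S) (U k))%E.
  apply: filter_forall => k; apply: Fopen => //.
  by rewrite EFinB fineK ?mfin_fin_num// lteBlDr// lteDl ?mfin_fin_num//
    lte_fin invr_gt0.
apply: filterS FU => nu nuU.
have /andP[_ muP] := layer_Rintegral mu n ch h01.
have /andP[nuP _] := layer_Rintegral nu n ch h01.
have : \sum_(k < n) fine (mu (U k)) - 1 <= \sum_(k < n) fine (nu (U k)).
  have <- : \sum_(k < n) (n%:R^-1 : R) = 1.
    by rewrite sumr_const card_ord -[n%:R^-1 *+ n]mulr_natl mulfV// gt_eqF.
  by rewrite -sumrB; apply: ler_sum => k _; rewrite ltW// -lte_fin fineK
    ?mfin_fin_num//.
move: nP; rewrite ltr_pdivrMr// -(ltr_pM2l n0 q).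
move: muP nuP; rewrite -/M /U; set a := \sum_(k < n) _; set b := \sum_(k < n) _.
lra.
Qed.

(** An affine change of [phi] yields [h] with values between 0 and 1. Lower semicontinuity for [h]
    and for [1 - h], with convergence of the total masses, bounds the integral of [h] from both
    sides. *)
Lemma portmanteau (F : set_system (Mfin R S)) (mu : Mfin R S) : Filter F ->
  (forall (U : set S) (q : R), open U -> (q%:E < mu U)%E ->
    \forall nu \near F, (q%:E < (nu : Mfin R S) U)%E) ->
  (forall q : R, (mu setT < q%:E)%E ->
    \forall nu \near F, ((nu : Mfin R S) setT < q%:E)%E) ->
  F --> mu.
Proof.
move=> FF Fopen Fmass; apply: mfin_cvg_eval => -[phi [cphi bphi]] /=.
have [M M0 phiM] : exists2 M, 0 < M & forall x, `|phi x| <= M.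
  have [M [_ /(_ (`|M| + 1)) phiM]] := bphi.
  exists (`|M| + 1); first by rewrite ltr_wpDl.
  by move=> x; apply: phiM => //; rewrite (le_lt_trans (ler_norm M))// ltrDl.
pose h x := (phi x + M) / (2 * M).
have M20 : 0 < 2 * M by rewrite mulr_gt0.
have h01 x : 0 <= h x <= 1.
  have := phiM x; rewrite ler_norml => /andP[? ?].
  rewrite /h divr_ge0//=; [|lra|exact: ltW].
  by rewrite ler_pdivrMr// mul1r; lra.
have h01' x : 0 <= 1 - h x <= 1 by have := h01 x; lra.
have ch : continuous h.
  by move=> x; apply: cvgMr_tmp; apply: cvgD; [exact: cphi|exact: cvg_cst].
have ch' : continuous (fun x => 1 - h x).
  by move=> x; apply: cvgB; [exact: cvg_cst|exact: ch].
have ih (nu : Mfin R S) : nu.-integrable setT (EFin \o (h : borel S -> R)).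
  by apply: bounded_continuous_integrable => //; exact: unit_bounded.
have i1 (nu : Mfin R S) (c : R) :
    nu.-integrable setT (EFin \o ((fun=> c) : borel S -> R)).
  apply: bounded_continuous_integrable; last exact: bounded_cst.
  by move=> x; exact: cvg_cst.
have phiE (nu : Mfin R S) :
    \int[nu]_x (phi x) = 2 * M * \int[nu]_x (h x) - M * fine (nu setT).
  have -> : phi = fun x => 2 * M * h x - M.
    by apply/funext => x; rewrite /h mulrC divfK ?gt_eqF// addrK.
  rewrite RintegralB//; last 2 first.
  - exact: (integrableZl measurableT _ (ih nu)).
  - exact: (i1 nu M).
  by rewrite Rintegral_cst// RintegralZl//; exact: ih.
have h'E (nu : Mfin R S) : \int[nu]_x (1 - h x) = fine (nu setT) - \int[nu]_x (h x).
  by rewrite RintegralB ?Rintegral_cst ?mul1r//; [exact: (i1 nu 1)|exact: ih].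
have massF : (fun nu : Mfin R S => fine (nu setT)) @ F --> fine (mu setT).
  apply/cvgrPdist_lt => e e0.
  have H1 := Fopen setT (fine (mu setT) - e) openT.
  have H2 := Fmass (fine (mu setT) + e).
  near=> nu; rewrite ltr_distlC; apply/andP; split.
  - rewrite -lte_fin fineK ?mfin_fin_num//; near: nu; apply: H1.
    by rewrite EFinB fineK ?mfin_fin_num// lteBlDr// lteDl ?mfin_fin_num.
  - rewrite -lte_fin fineK ?mfin_fin_num//; near: nu; apply: H2.
    by rewrite EFinD fineK ?mfin_fin_num// lteDl ?mfin_fin_num.
have hF : (fun nu : Mfin R S => \int[nu]_x (h x)) @ F --> \int[mu]_x (h x).
  apply/cvgrPdist_lt => e e0.
  have H1 := lsc_integral FF Fopen ch h01.
  have H2 := lsc_integral FF Fopen ch' h01'.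
  have e20 : 0 < e / 2 by rewrite divr_gt0.
  near=> nu; rewrite ltr_distlC; apply/andP; split.
  - by near: nu; apply: H1; rewrite ltrBlDr ltrDl.
  - have : \int[mu]_x (1 - h x) - e / 2 < \int[nu]_x (1 - h x).
      by near: nu; apply: H2; rewrite ltrBlDr ltrDl.
    have : `|fine (mu setT) - fine (nu setT)| < e / 2.
      by near: nu; move/cvgrPdist_lt : massF; exact.
    by rewrite !h'E ltr_distlC => /andP[]; lra.
rewrite phiE (_ : (fun nu => _) = (fun nu : Mfin R S =>
  2 * M * \int[nu]_x (h x) - M * fine (nu setT))); last exact/funext.
by apply: cvgB; exact: cvgMl_tmp.
Unshelve. all: by end_near. Qed.

End weak_limits.

(** * Masses of open sets as functions of the measure *)

Section metric_weak_topology.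
Context {R : realType} {E : completeMetricType R}.
Implicit Types (U : set E) (q : R).

Lemma tent_unit U n (x : E) : 0 <= tent U n x <= 1.
Proof. by rewrite tent_ge0 tent_le1. Qed.

Lemma tent_borel U n : measurable_fun setT (tent U n : borel E -> R).
Proof. by apply: continuous_borel; exact: tent_continuous. Qed.

Lemma cvg_integral_tent (mu : {measure set (borel E) -> \bar R}) U : open U ->
  (\int[mu]_x (tent U n x)%:E)%E @[n --> \oo] --> mu U.
Proof.
move=> oU; have mU := open_borel oU.
have -> : mu U = (\int[mu]_x (limn (fun n => (tent U n x)%:E)))%E.
  rewrite -[LHS]/(mu U) -[in LHS](setIT U) -(integral_indic mu measurableT)//.
  apply: eq_integral => x _; apply/esym/cvg_lim => //.
  apply: cvg_EFin; first exact: nearW.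
  exact: cvg_tent.
apply: cvg_monotone_convergence => //.
- by move=> n; apply/measurable_EFinP; exact: tent_borel.
- by move=> n x _; rewrite lee_fin tent_ge0.
- by move=> x _ m n mn; rewrite lee_fin tent_nd.
Qed.

Lemma integral_tent_le (mu : {measure set (borel E) -> \bar R}) U n : open U ->
  (\int[mu]_x (tent U n x)%:E <= mu U)%E.
Proof.
move=> oU; have mU := open_borel oU.
rewrite -(setIT U) -(integral_indic mu measurableT)//.
apply: ge0_le_integral => //.
- by move=> x _; rewrite lee_fin tent_ge0.
- by apply/measurable_EFinP; exact: tent_borel.
- by apply/measurable_EFinP; exact: measurable_indic.
- by move=> x _; rewrite setIT lee_fin tent_le_indic.
Qed.

(** By monotone convergence along the tents, [nu U] is a supremum of weakly continuous functions of
    [nu]. *)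
Lemma mfin_gt_open U q : open U -> open [set nu : Mfin R E | (q%:E < nu U)%E].
Proof.
move=> oU; have -> : [set nu : Mfin R E | (q%:E < nu U)%E] =
    \bigcup_n [set nu : Mfin R E | q < \int[nu]_x (tent U n x)].
  have tentE (nu : Mfin R E) n :
      ((\int[nu]_x (tent U n x))%:E = \int[nu]_x (tent U n x)%:E)%E.
    rewrite fineK//; apply: integrable_fin_num => //.
    apply: bounded_continuous_integrable; first exact: tent_continuous.
    by apply: unit_bounded => x; exact: tent_unit.
  apply/seteqP; split => nu /=.
  - move=> qU; have := cvg_integral_tent (mu := nu) oU.
    move=> /(_ [set y | (q%:E < y)%E]) [].
      by apply: open_nbhs_nbhs; split => //; exact: open_ereal_gt_ereal.
    by move=> n _ /(_ n (leqnn n)) /=; rewrite -tentE lte_fin => qn; exists n.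
  - move=> [n _ /=]; rewrite -lte_fin tentE => /lt_le_trans; apply.
    exact: integral_tent_le.
apply: bigcup_open => n _.
pose ev (nu : Mfin R E) := \int[nu]_x (tent U n x).
have cev : continuous ev.
  apply: mfin_eval_continuous; first exact: tent_continuous.
  by apply: unit_bounded => x; exact: tent_unit.
rewrite (_ : mkset _ = ev @^-1` [set y | q < y])//.
by move/continuousP : cev; apply; exact: open_gt.
Qed.

Lemma mfin_le_closed U q : open U -> closed [set nu : Mfin R E | (nu U <= q%:E)%E].
Proof.
move=> oU; rewrite -[X in closed X]setCK; apply: open_closedC.
rewrite (_ : ~` _ = [set nu : Mfin R E | (q%:E < nu U)%E]); first exact: mfin_gt_open.
by apply/seteqP; split => nu /=; [move/negP; rewrite -ltNge|rewrite ltNge => /negP].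
Qed.

End metric_weak_topology.

(** * Extension of a compact content *)

Section compact_content.
Context {R : realType} {E : completeMetricType R}.

Lemma metric_compact_closed (H : set E) : compact H -> closed H.
Proof. by apply: compact_closed; exact: metric_hausdorff. Qed.

Lemma compact_setU (A B : set E) : compact A -> compact B -> compact (A `|` B).
Proof.
move=> cA cB; pose F b := if b then A else B.
have := @bigsetU_compact E bool F [:: true; false] xpredT.
by rewrite !big_cons big_nil setU0/= /F; apply; case.
Qed.

(* Each point of H is put in the part of the cover whose complement is farther
   away from it. *)
Lemma compact_split (H G1 G2 : set E) : compact H -> open G1 -> open G2 ->
  H `<=` G1 `|` G2 -> exists H1 H2 : set E,
  [/\ compact H1, compact H2, H1 `<=` G1, H2 `<=` G2 & H = H1 `|` H2].
Proof.
move=> cH oG1 oG2 HG.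
pose D (G1 G2 : set E) := [set x | dset (~` G2) x <= dset (~` G1) x].
have cD A B : closed (D A B).
  pose g x := dset (~` A) x - dset (~` B) x.
  have cg : continuous g by move=> x; apply: cvgB; exact: dset_continuous.
  rewrite (_ : D A B = g @^-1` [set y | 0 <= y]); last first.
    by apply/seteqP; split=> x /=; rewrite subr_ge0.
  by move/continuous_closedP : cg; apply; exact: closed_ge.
have DG A B : open A -> open B -> H `<=` A `|` B -> H `&` D A B `<=` A.
  move=> oA oB HAB x [Hx Dx]; apply: contrapT => nAx.
  have [//|Bx] := HAB _ Hx.
  have := Dx; rewrite /D/= (dset_eq0 (A := ~` A))// leNgt => /negP; apply.
  by apply: dset_gt0; [exact: open_closedC|exact].
exists (H `&` D G1 G2), (H `&` D G2 G1); split.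
- by apply: compact_closedI.
- by apply: compact_closedI.
- exact: DG.
- by apply: DG => //; rewrite setUC.
- rewrite -setIUr; apply/esym/setIidl => x _ /=.
  by have [?|/ltW ?] := leP (dset (~` G2) x) (dset (~` G1) x); [left|right].
Qed.

Variables (alpha : set E -> R) (C : R).
Hypothesis alpha_ge0 : forall H, compact H -> 0 <= alpha H.
Hypothesis alpha_le : forall H, compact H -> alpha H <= C.
Hypothesis alphaU_le : forall H H', compact H -> compact H' ->
  alpha (H `|` H') <= alpha H + alpha H'.
Hypothesis alphaU : forall H H', compact H -> compact H' -> H `&` H' = set0 ->
  alpha (H `|` H') = alpha H + alpha H'.

Local Open Scope ereal_scope.

(** Meant for open [G]. With [outer_content] this is the classical extension of a content: to open
    sets from inside by compact sets, then to all sets from outside by open sets. *)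
Definition inner_content (G : set E) : \bar R :=
  ereal_sup [set (alpha H)%:E | H in [set H | compact H /\ H `<=` G]].

Definition outer_content (A : set E) : \bar R :=
  ereal_inf [set inner_content G | G in [set G | open G /\ A `<=` G]].

Local Notation beta := inner_content.
Local Notation gamma := outer_content.

Lemma inner_content_ge (H G : set E) : compact H -> H `<=` G ->
  (alpha H)%:E <= beta G.
Proof. by move=> cH HG; apply: ereal_sup_ubound; exists H. Qed.

Lemma inner_content_le (G : set E) x :
  (forall H, compact H -> H `<=` G -> (alpha H)%:E <= x) -> beta G <= x.
Proof. by move=> Hx; apply: ge_ereal_sup => _ [H [cH HG] <-]; exact: Hx. Qed.

Lemma inner_content_ge0 G : 0 <= beta G.
Proof.
apply: le_trans (inner_content_ge (@compact0 E) (@sub0set _ G)).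
by rewrite lee_fin alpha_ge0//; exact: compact0.
Qed.

Lemma inner_content_leC G : beta G <= C%:E.
Proof. by apply: inner_content_le => H cH _; rewrite lee_fin alpha_le. Qed.

Lemma inner_content_fin G : beta G \is a fin_num.
Proof.
by rewrite ge0_fin_numE ?inner_content_ge0// (le_lt_trans (inner_content_leC G))// ltry.
Qed.

Lemma le_inner_content G G' : G `<=` G' -> beta G <= beta G'.
Proof.
move=> GG'; apply: inner_content_le => H cH HG.
by apply: inner_content_ge => //; exact: subset_trans GG'.
Qed.

Lemma inner_content0 : beta set0 = 0.
Proof.
apply/eqP; rewrite eq_le inner_content_ge0 andbT.
apply: inner_content_le => H cH; rewrite subset0 => ->.
(* The empty set is disjoint from itself, so additivity gives [alpha set0 = 2 * alpha set0]. *)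
have := @alphaU set0 set0 (@compact0 E) (@compact0 E) (setI0 _).
by rewrite setU0 => /eqP; rewrite -subr_eq subrr lee_fin => /eqP <-.
Qed.

(** A compact subset of the union is cut by [compact_split] into compact subsets of [G1] and
    [G2]. *)
Lemma inner_contentU_le G1 G2 : open G1 -> open G2 ->
  beta (G1 `|` G2) <= beta G1 + beta G2.
Proof.
move=> oG1 oG2; apply: inner_content_le => H cH HG.
have [H1 [H2 [cH1 cH2 H1G H2G ->]]] := compact_split cH oG1 oG2 HG.
apply: (@le_trans _ _ (alpha H1 + alpha H2)%R%:E).
  by rewrite lee_fin alphaU_le.
by rewrite EFinD leeD// inner_content_ge.
Qed.

(** A compact subset of the union already lies in a finite partial union, where finite subadditivity
    applies. *)
Lemma inner_content_bigcup_le (G : (set E)^nat) : (forall n, open (G n)) ->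
  beta (\bigcup_n G n) <= \sum_(n <oo) beta (G n).
Proof.
move=> oG; pose U N := \big[setU/set0]_(n < N) G n.
have UN N : open (U N) /\ beta (U N) <= \sum_(0 <= n < N) beta (G n).
  elim: N => [|N [oU IH]].
    rewrite /U big_ord0 big_geq// inner_content0.
    by split => //; exact: open0.
  rewrite /U big_ord_recr/=; split; first exact: openU.
  rewrite big_nat_recr//= (le_trans (inner_contentU_le _ _))//.
  exact: leeD.
apply: inner_content_le => H cH HG.
have [N _ /(_ _ (leqnn N)) HN] : \forall N \near \oo, H `<=` U N.
  move/compact_near_coveringP : cH => /(_ nat \oo (fun N => U N)); apply.
  move=> x /HG [n _ Gnx]; exists (G n, [set N | (n < N)%N]) => /=.
    split; first by apply: open_nbhs_nbhs; split.
    by exists n.+1.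
  move=> [y N]/= [Gny nN]; rewrite /U -bigcup_mkord.
  by exists n.
apply: le_trans (nneseries_lim_ge N _); last by move=> k _ _; exact: inner_content_ge0.
by apply: le_trans (UN N).2; exact: inner_content_ge.
Qed.

Lemma outer_content_open G : open G -> gamma G = beta G.
Proof.
move=> oG; apply/eqP; rewrite eq_le; apply/andP; split.
  by apply: ereal_inf_lbound; exists G => //; split.
by apply: le_ereal_inf_tmp => _ [G' [_ GG'] <-]; exact: le_inner_content.
Qed.

Lemma outer_content_le A G : open G -> A `<=` G -> gamma A <= beta G.
Proof. by move=> oG AG; apply: ereal_inf_lbound; exists G. Qed.

Lemma outer_content_ge0 A : 0 <= gamma A.
Proof. by apply: le_ereal_inf_tmp => _ [G _ <-]; exact: inner_content_ge0. Qed.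

Lemma outer_content0 : gamma set0 = 0.
Proof. by rewrite outer_content_open ?inner_content0//; exact: open0. Qed.

Lemma le_outer_content : {homo gamma : A B / A `<=` B >-> A <= B}.
Proof.
move=> A B AB; apply: le_ereal_inf_tmp => _ [G [oG BG] <-].
by apply: outer_content_le => //; exact: subset_trans BG.
Qed.

Lemma outer_content_fin A : gamma A \is a fin_num.
Proof.
rewrite ge0_fin_numE ?outer_content_ge0//.
have : gamma A <= beta setT by apply: outer_content_le => //; exact: openT.
by move/le_lt_trans; apply; rewrite (le_lt_trans (inner_content_leC _))// ltry.
Qed.

Lemma outer_content_approx A (e : R) : (0 < e)%R ->
  exists G, [/\ open G, A `<=` G & beta G <= gamma A + e%:E].
Proof.
move=> e0; have [_ [G [oG AG] <-] Ge] := lb_ereal_inf_adherent e0 (outer_content_fin A).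
by exists G; split => //; exact: ltW.
Qed.

(** Each [A n] is enclosed in an open set costing at most [e / 2 ^ (n + 1)] more, and these excesses
    add up to [e]. *)
Lemma outer_content_sigma_subadditive : sigma_subadditive gamma.
Proof.
move=> A; apply/lee_addgt0Pr => e e0.
rewrite (le_trans _ (epsilon_trick _ _ _))//; last 2 first.
- by move=> n; exact: outer_content_ge0.
- exact: ltW.
have en n : (0 < e / (2 ^ n.+1)%:R)%R by rewrite divr_gt0// ltr0n expn_gt0.
have [G PG] := choice (fun n => outer_content_approx (A n) (en n)).
have oG n : open (G n) by have [] := PG n.
apply: (@le_trans _ _ (beta (\bigcup_n G n))).
  apply: outer_content_le; first by apply: bigcup_open => n _.
  by apply: subset_bigcup => n _; have [] := PG n.
apply: le_trans (inner_content_bigcup_le oG) _.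
by apply: lee_nneseries => n *; [exact: inner_content_ge0|have [] := PG n].
Qed.

HB.instance Definition _ := isOuterMeasure.Build R E gamma
  outer_content0 outer_content_ge0 le_outer_content outer_content_sigma_subadditive.

(** Let [G] be open around [A]. Take a compact [H1] in [G] minus [F], then a compact [H0] in [G]
    minus [H1], an open set that contains the trace of [F] on [G]. They are disjoint, so
    [alpha H0 + alpha H1] is the value of [alpha] at a compact subset of [G]. *)
Lemma closed_caratheodory (F : set E) : closed F -> gamma.-caratheodory F.
Proof.
move=> cF; apply: le_caratheodory_measurable => A.
apply: le_ereal_inf_tmp => _ [G [oG AG] <-].
apply: (@le_trans _ _ (gamma (G `&` F) + gamma (G `&` ~` F))).
  by apply: leeD; apply: le_outer_content; exact: setSI.
have oGF : open (G `&` ~` F) by apply: openI => //; exact: closed_openC.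
(* The goal is rearranged until a supremum over compact sets stands alone on the left; finiteness of
   the contents permits the subtractions. *)
rewrite (outer_content_open oGF) -leeBrDr ?inner_content_fin//.
rewrite leeBrDr ?inner_content_fin// addeC -leeBrDr ?outer_content_fin//.
apply: inner_content_le => H1 cH1 H1G.
have oGH : open (G `&` ~` H1).
  by apply: openI => //; apply: closed_openC; exact: metric_compact_closed.
rewrite leeBrDr ?outer_content_fin// addeC -leeBrDr//.
apply: (@le_trans _ _ (beta (G `&` ~` H1))).
  apply: outer_content_le => // x [Gx Fx]; split => // /H1G [].
  by move=> _; exact.
apply: inner_content_le => H0 cH0 H0G.
rewrite leeBrDr// -EFinD -alphaU//; last first.
  by apply/seteqP; split => // x [/H0G[_ ]].
apply: inner_content_ge; first exact: compact_setU.
by move=> x [/H0G[]|/H1G[]].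
Qed.

Lemma borel_caratheodory (A : set (borel E)) : measurable A -> gamma.-caratheodory A.
Proof.
move: A; apply: smallest_sub.
  exact: (@sigma_algebra_measurable _ (caratheodory_type gamma)).
move=> G oG; rewrite -[G]setCK; apply: caratheodory_measurable_setC.
by apply: closed_caratheodory; exact: open_closedC.
Qed.

(** All Borel sets are Caratheodory measurable for [outer_content], so its restriction to them is
    countably additive. *)
Lemma compact_content_measure :
  exists mu : Mfin R E, forall G, open G -> mu G = inner_content G.
Proof.
pose m : set (borel E) -> \bar R := gamma.
have m0 : m set0 = 0 by exact: outer_content0.
have m_ge0 A : 0 <= m A by exact: outer_content_ge0.
have m_sigma : semi_sigma_additive m.
  move=> A mA tA mUA.
  apply: (@caratheodory_measure_sigma_additive _ _ gamma A) => //.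
  - by move=> i; exact: borel_caratheodory.
  - exact: borel_caratheodory.
pose mm := isMeasure.Build _ _ _ m m0 m_ge0 m_sigma.
pose M : {measure set (borel E) -> \bar R} := HB.pack m mm.
have MT : M setT < +oo.
  by rewrite /= -ge0_fin_numE//; exact: outer_content_fin.
exists (mfin_of MT) => G oG; rewrite mfin_ofE; last exact: open_borel.
exact: outer_content_open.
Qed.

End compact_content.

(** * Compactness of tight sets of measures *)

(** Compactness gives a cluster point, and an ultrafilter converges to its cluster points: it
    contains each set or the complement. *)
Lemma ultra_cvg_compact {T : Type} {U : topologicalType} (F : set_system T)
    (g : T -> U) (A : set U) : UltraFilter F -> compact A -> F (g @^-1` A) ->
  exists2 p, A p & g @ F --> p.
Proof.
move=> FU cA FA; have [p [Ap clp]] := cA (g @ F) _ FA.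
exists p => // B; rewrite nbhsE => -[V [oV Vp] VB].
have [FV|FV] := in_ultra_setVsetC (g @^-1` V) FU.
  by apply: filterS FV => x; exact: VB.
have [y [/= nVy Vy]] := clp (~` V) V FV (open_nbhs_nbhs (conj oV Vp)).
by [].
Qed.

Section prokhorov.
Context {R : realType} {E : completeMetricType R}.

(** A bounded, uniformly tight set of measures in normal form: the countably many tolerances
    [1 / (n + 1)] stand for all positive ones. *)
Definition tight_ball (C : R) (K : (set E)^nat) : set (Mfin R E) :=
  [set nu | (nu setT <= C%:E)%E /\ forall n, (nu (~` K n) <= (n.+1%:R^-1)%:E)%E].

(** Every constraint bounds from above the mass of an open set, which is a closed condition by lower
    semicontinuity. *)
Lemma tight_ball_closed C (K : (set E)^nat) : (forall n, compact (K n)) ->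
  closed (tight_ball C K).
Proof.
move=> cK; rewrite (_ : tight_ball C K =
    [set nu : Mfin R E | (nu setT <= C%:E)%E] `&`
    \bigcap_n [set nu : Mfin R E | (nu (~` K n) <= (n.+1%:R^-1)%:E)%E]).
  apply: closedI; first by apply: mfin_le_closed; exact: openT.
  apply: closed_bigI => n _; apply: mfin_le_closed.
  by apply: closed_openC; exact: metric_compact_closed.
apply/seteqP; split => nu [nuC nuK]; split => // n; first by move=> _; exact: nuK.
exact: nuK.
Qed.

Section ultrafilter_limit.
Variables (C : R) (K : (set E)^nat) (F : set_system (Mfin R E)).
Hypothesis cK : forall n, compact (K n).
Hypothesis FU : UltraFilter F.
Hypothesis FK : F (tight_ball C K).

Let mass (A : set E) (nu : Mfin R E) : R := fine (nu A).

Let massE A nu : (mass A nu)%:E = nu A.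
Proof. by rewrite fineK// mfin_fin_num. Qed.

Let mass_le A B nu : measurable (A : set (borel E)) ->
  measurable (B : set (borel E)) -> A `<=` B -> mass A nu <= mass B nu.
Proof. by move=> mA mB AB; rewrite -lee_fin !massE le_measure ?inE. Qed.

(** A genuine limit for Borel [A], not a default value: the masses lie in the compact interval from
    0 to [C], where the ultrafilter has to converge. *)
Let alpha (A : set E) : R := lim (mass A @ F).

Let mass_itv A : measurable (A : set (borel E)) ->
  F [set nu | 0 <= mass A nu <= C].
Proof.
move=> mA; apply: filterS FK => nu [nuC _]/=; rewrite fine_ge0//=.
by rewrite (le_trans (mass_le nu mA measurableT _))// -lee_fin massE.
Qed.

Let cvg_alpha A : measurable (A : set (borel E)) -> mass A @ F --> alpha A.
Proof.
move=> mA; have [||p _] := @ultra_cvg_compact _ R F (mass A) `[0, C]%classic.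
- exact: segment_compact.
- by apply: filterS (mass_itv mA) => nu /=; rewrite in_itv.
- by move=> Fp; apply/cvg_ex; exists p.
Qed.

Let mcompact (H : set E) : compact H -> measurable (H : set (borel E)).
Proof. by move=> cH; apply: closed_borel; exact: metric_compact_closed. Qed.

Let alpha_itv A : measurable (A : set (borel E)) -> 0 <= alpha A <= C.
Proof.
move=> mA; apply/andP; split.
- apply: (cvgr_to_ge (cvg_alpha mA)).
  by apply: filterS (mass_itv mA) => nu /= /andP[].
- apply: (cvgr_to_le (cvg_alpha mA)).
  by apply: filterS (mass_itv mA) => nu /= /andP[].
Qed.

Let cvg_le (g h : Mfin R E -> R) a b : g @ F --> a -> h @ F --> b ->
  (\forall nu \near F, g nu <= h nu) -> a <= b.
Proof. by move=> ga hb; exact: ler_cvg_to ga hb. Qed.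

Let alphaU_le A B : measurable (A : set (borel E)) ->
  measurable (B : set (borel E)) -> alpha (A `|` B) <= alpha A + alpha B.
Proof.
move=> mA mB; have mAB : measurable (A `|` B : set (borel E)) by exact: measurableU.
apply: (cvg_le (cvg_alpha mAB) (cvgD (cvg_alpha mA) (cvg_alpha mB))).
by apply: nearW => nu; rewrite -lee_fin EFinD !massE measureU2.
Qed.

Let alphaU A B : measurable (A : set (borel E)) ->
  measurable (B : set (borel E)) -> A `&` B = set0 ->
  alpha (A `|` B) = alpha A + alpha B.
Proof.
move=> mA mB AB; have mAB : measurable (A `|` B : set (borel E)) by exact: measurableU.
apply: (cvg_unique _ (cvg_alpha mAB)); first exact: norm_hausdorff.
rewrite (_ : mass _ = fun nu => mass A nu + mass B nu).
  exact: cvgD (cvg_alpha mA) (cvg_alpha mB).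
by apply/funext => nu; apply: EFin_inj; rewrite EFinD !massE measureU.
Qed.

Lemma tight_ball_limit : exists mu : Mfin R E, F --> mu.
Proof.
have [mu muE] : exists mu : Mfin R E, forall G, open G -> mu G = inner_content alpha G.
  apply: (@compact_content_measure _ _ alpha C).
  - by move=> H /mcompact/alpha_itv/andP[].
  - by move=> H /mcompact/alpha_itv/andP[].
  - by move=> H H' /mcompact mH /mcompact mH'; exact: alphaU_le.
  - by move=> H H' /mcompact mH /mcompact mH'; exact: alphaU.
have FF : Filter F by exact: filter_filter.
exists mu; apply: portmanteau.
(* Some compact [H] inside [U] has [alpha H > q], and the masses of [H] converge to [alpha H]. *)
- move=> U q oU; rewrite (muE _ oU) => /ereal_sup_gt[_ [H [cH HU] <-]].
  rewrite lte_fin => qH.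
  have FqH : \forall nu \near F, q < mass H nu.
    exact: (cvgr_gt _ (cvg_alpha (mcompact cH)) _ qH).
  apply: filterS FqH => nu qnu; rewrite -massE lte_fin (lt_le_trans qnu)//.
  by apply: mass_le => //; [exact: mcompact|exact: open_borel].
- move=> q; rewrite (muE _ openT) => qmu.
  suff : alpha setT < q.
    move=> aq; have Fq : \forall nu \near F, mass setT nu < q.
      exact: (cvgr_lt _ (cvg_alpha measurableT) _ aq).
    by apply: filterS Fq => nu; rewrite -lte_fin massE.
  (* No mass escapes: [alpha setT] exceeds [alpha (K n)] by at most [1 / (n + 1)], and [alpha (K n)]
     is at most the inner content of the whole space. *)
  rewrite -lte_fin; apply: le_lt_trans qmu.
  apply/lee_addgt0Pr => e e0.
  have [n ne] : exists n : nat, n.+1%:R^-1 < e.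
    exists (Num.truncn e^-1).
    by rewrite invf_plt ?posrE// truncnS_gt.
  apply: (@le_trans _ _ (alpha (K n) + e)%:E); last first.
    by rewrite EFinD leeD2r//; exact: inner_content_ge.
  rewrite lee_fin.
  have mK := mcompact (@cK n).
  apply: (cvg_le (cvg_alpha measurableT) (cvgD (cvg_alpha mK) (cvg_cst e))).
  apply: filterS FK => nu [_ /(_ n) nuK].
  rewrite -lee_fin EFinD -[X in (mass X _)%:E](setUv (K n)) !massE.
  rewrite measureU//; [|exact: measurableC|by rewrite setICr].
  by rewrite leeD2l// (le_trans nuK)// lee_fin ltW.
Qed.

End ultrafilter_limit.

(** Compactness is tested on ultrafilters: [tight_ball_limit] supplies a limit and closedness keeps
    it in the ball. *)
Lemma tight_ball_compact C (K : (set E)^nat) : (forall n, compact (K n)) ->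
  compact (tight_ball C K).
Proof.
move=> cK; rewrite compact_ultra => F FU FK.
have [mu Fmu] := tight_ball_limit cK FU FK.
exists mu; split => //; apply: tight_ball_closed => // B /Fmu FB.
exact: filter_ex (filterI FK FB).
Qed.

End prokhorov.

(** * Measurability of maps into the space of finite measures *)

Section countable_base.
Context {R : realType} {E : completeMetricType R}.

Lemma metric_ball_open (x : E) (r : R) : open (ball x r).
Proof.
rewrite openE => y; rewrite ballEmdist/= => xyr.
have d0 : 0 < r - mdist x y by rewrite subr_gt0.
apply: filterS (nbhsx_ballx y _ d0) => z; rewrite !ballEmdist/= ltrBrDl.
exact/le_lt_trans/metric_triangle.
Qed.

Lemma separable_base : separable E -> exists V : nat -> set E,
  (forall k, open (V k)) /\
  forall (U : set E) x, open U -> U x -> exists2 k, V k x & V k `<=` U.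
Proof.
move=> [D /pfcard_geP[D0|[e]] dD].
  (* The space is pointed, so a dense set cannot be empty. *)
  have [y [_]] := dD setT (ex_intro _ point I) openT.
  by rewrite D0.
(* Balls of radius [1 / (n + 1)] about the enumerated dense points [e i], the pair [(i, n)] being
   coded by one number; numbers that code no pair get the empty set. *)
pose V k := if unpickle k is Some (i, n) then ball (e i) (n.+1%:R^-1 : R) else set0.
exists V; split => [k|U x oU Ux].
  rewrite /V; case: (unpickle k) => [[i n]|]; last exact: open0.
  exact: metric_ball_open.
have [r /= r0 rU] : nbhs_ball x U by rewrite nbhs_ballE; exact: open_nbhs_nbhs.
have [n nr] : exists n : nat, n.+1%:R^-1 < r / 2.
  exists (Num.truncn (r / 2)^-1).
  by rewrite invf_plt ?posrE ?divr_gt0// truncnS_gt.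
have n0 : 0 < n.+1%:R^-1 :> R by rewrite invr_gt0.
have [y [xy Dy]] : ball x (n.+1%:R^-1) `&` D !=set0.
  by apply: dD; [exists x; exact: ballxx|exact: metric_ball_open].
have [i _ eiy] : (e @` setT) y by have := @surj _ _ _ _ e; apply.
have Vk : V (pickle (i, n)) = ball y n.+1%:R^-1 by rewrite /V pickleK eiy.
exists (pickle (i, n)); rewrite Vk; first exact: ball_sym.
move=> z yz; apply: rU; rewrite (splitr r).
apply: (@ball_triangle _ _ y); first exact: le_ball (ltW nr) _ xy.
exact: le_ball (ltW nr) _ yz.
Qed.

Hypothesis E_separable : separable E.

(* Finite intersections, indexed by sequences, of the sets {mu(W) > q} with W
   a finite union of basic open sets, and {mu(E) < q}, with q rational. *)
Lemma mfin_base : exists B : seq (seq nat * rat + rat) -> set (Mfin R E),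
  (forall d (T : measurableType d) (D : set T) (g : T -> Mfin R E), measurable D ->
    (forall U, open U -> measurable_fun D (fun t => g t U)) ->
    forall l, measurable (D `&` g @^-1` B l)) /\
  forall (O : set (Mfin R E)) mu, open O -> O mu -> exists2 l, B l mu & B l `<=` O.
Proof.
have [V [oV Vbase]] := separable_base E_separable.
pose W (s : seq nat) := \big[setU/set0]_(k <- s) V k.
have oW s : open (W s).
  rewrite /W; elim: s => [|k s IH]; rewrite ?big_nil ?big_cons; first exact: open0.
  exact: openU.
pose S (c : seq nat * rat + rat) : set (Mfin R E) := match c with
  | inl (s, q) => [set nu | ((ratr q)%:E < nu (W s))%E]
  | inr q => [set nu | (nu setT < (ratr q)%:E)%E]
  end.
pose B := fix B (l : seq (seq nat * rat + rat)) : set (Mfin R E) :=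
  if l is c :: l then S c `&` B l else setT.
have Bcat l l' : B (l ++ l') = B l `&` B l'.
  by elim: l => [|c l IH]/=; rewrite ?setTI// IH setIA.
exists B; split=> [d T D g mD mg|O mu oO Omu].
  elim => [|c l IH]/=; first by rewrite preimage_setT setIT.
  rewrite preimage_setI (_ : _ `&` _ = (D `&` g @^-1` S c) `&` (D `&` g @^-1` B l)).
    apply: measurableI => //; case: c => [[s q]|q].
    - exact: emeasurable_fun_o_infty (mg _ (oW s)) _.
    - exact: emeasurable_fun_infty_o (mg _ openT) _.
  by apply/seteqP; split => t /=; tauto.
(* The sets [B l] that contain [mu] generate a filter. Once it converges to [mu], every
   neighbourhood of [mu] contains one of them. *)
pose G := filter_from [set l | B l mu] B.
have FG : Filter G.
  apply: filter_from_filter; first by exists [::].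
  by move=> l l' Bl Bl'; exists (l ++ l'); rewrite /= ?Bcat.
suff : G --> mu by move=> /(_ O) [|l]; [exact: open_nbhs_nbhs|move=> Bl BO; exists l].
apply: portmanteau => [U q oU qU|q muq].
(* The unions of the basic sets of index below [N] that lie in [U] increase to [U], so one of them
   has mass above a rational [p > q]. *)
- pose s N := [seq k <- iota 0 N | `[< V k `<=` U >]].
  have WE N : W (s N) = [set x | exists2 k, (k < N)%N /\ V k `<=` U & V k x].
    rewrite /W -bigcup_seq; apply/seteqP; split => x [k].
    - by rewrite /= mem_filter mem_iota => /andP[/asboolP kU kN] kx; exists k.
    - by move=> [kN /asboolP kU] kx; exists k => //; rewrite /= mem_filter mem_iota kU.
  have UE : \bigcup_N W (s N) = U.
    apply/seteqP; split => x.
    - by move=> [N _]; rewrite WE => -[k [_ kU] /kU].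
    - by move=> /(Vbase _ _ oU)[k kx kU]; exists k.+1 => //; rewrite WE; exists k.
  have Wmu : mu (W (s N)) @[N --> \oo] --> mu U.
    rewrite -[in X in _ --> X]UE.
    apply: (@nondecreasing_cvg_mu _ (borel E) _ mu (fun N => W (s N))).
    + by move=> N; exact: open_borel.
    + by apply: bigcup_measurable => N _; exact: open_borel.
    + move=> m n mn; apply/subsetPset; rewrite !WE => x [k [km kU] kx].
      by exists k => //; split => //; exact: leq_trans mn.
  have [p qp pU] : exists2 p : rat, q < ratr p & ((ratr p)%:E < mu U)%E.
    have : q < fine (mu U) by rewrite -lte_fin fineK// mfin_fin_num.
    move=> /rat_in_itvoo[p]; rewrite in_itv/= => /andP[qp pU]; exists p => //.
    by rewrite -[mu U]fineK ?mfin_fin_num ?lte_fin.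
  have /Wmu[N _ /(_ N (leqnn N))/= pN] : nbhs (mu U) [set y | ((ratr p)%:E < y)%E].
    by apply: open_nbhs_nbhs; split => //; exact: open_ereal_gt_ereal.
  exists [:: inl (s N, p)] => //= nu [pnu _].
  apply: (@lt_trans _ _ (ratr p)%:E); first by rewrite lte_fin.
  apply: lt_le_trans pnu _; apply: le_measure; rewrite ?inE; [exact: open_borel..|].
  by rewrite WE => x [k [_ kU] /kU].
- have [p pmu pq] : exists2 p : rat, (mu setT < (ratr p)%:E)%E & ratr p < q.
    have : fine (mu setT) < q by rewrite -lte_fin fineK// mfin_fin_num.
    move=> /rat_in_itvoo[p]; rewrite in_itv/= => /andP[mup pq]; exists p => //.
    by rewrite -[mu setT]fineK ?mfin_fin_num ?lte_fin.
  exists [:: inr p] => //= nu [/lt_trans nup _]; apply: nup.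
  by rewrite lte_fin.
Qed.

(** Open sets generate the Borel sets, and each open set is the union of the countably many base
    sets inside it. *)
Lemma measurable_fun_mfin d (T : measurableType d) (D : set T) (g : T -> Mfin R E) :
  measurable D -> (forall U, open U -> measurable_fun D (fun t => g t U)) ->
  measurable_fun D (g : T -> borel (Mfin R E)).
Proof.
move=> mD mg; have [B [mB Bbase]] := mfin_base.
apply: (@measurability _ _ _ (borel (Mfin R E)) D g (@open (Mfin R E))) => //.
move=> _ [U oU <-].
have -> : D `&` g @^-1` U =
    \bigcup_l (if `[< B l `<=` U >] then D `&` g @^-1` B l else set0).
  apply/seteqP; split => t.
  - move=> [Dt /= /(Bbase _ _ oU)[l Bl BU]]; exists l => //.
    by rewrite asboolT.
  - by move=> [l _]; case: asboolP => // BU [Dt /BU].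
apply: countable_bigcupT_measurable; first exact: countableP.
by move=> l; case: ifP => // _; exact: mB.
Qed.

End countable_base.

(** * Integrals against atomic measures and mixtures *)

Section esum_scale.
Context {R : realType} {T : choiceType}.
Local Open Scope ereal_scope.

Lemma ge0_esumZl (S : set T) (a : T -> \bar R) (r : R) : (0 <= r)%R ->
  (forall x, 0 <= a x) -> \esum_(x in S) (r%:E * a x) = r%:E * \esum_(x in S) a x.
Proof.
move=> r0 a0; rewrite /esum -ereal_supZl//; last first.
  by apply/set0P; eexists; exists set0; [exact: fsets_set0|].
congr ereal_sup; apply/seteqP; split => y.
- move=> [A AS <-] /=; exists (\sum_(x \in A) a x); first by exists A.
  by rewrite ge0_mule_fsumr.
- move=> [_ [A AS <-] <-] /=; exists A => //.
  by rewrite ge0_mule_fsumr.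
Qed.

End esum_scale.

Section atomic_integral.
Import HBNNSimple.
Context d (T : measurableType d) (R : realType) (w : T -> R).
Hypothesis w0 : forall x, (0 <= w x)%R.
Local Open Scope ereal_scope.
Local Notation mu := (atomic w0).

(** The sum over the finitely many values of [h] is exchanged with the sum over the atoms. *)
Let integral_atomic_nnsfun (h : {nnsfun T >-> R}) :
  \int[mu]_x (h x)%:E = \esum_(x in [set: T]) (w x * h x)%:E.
Proof.
rewrite integralT_nnsfun sintegralE fsbig_finite//.
have aE r : (0 <= r)%R -> r%:E * mu (h @^-1` [set r]) =
    \esum_(x in [set: T]) (r * (w x * \1_(h @^-1` [set r]) x))%:E.
  move=> r0; rewrite -[LHS]/(r%:E * \esum_(x in h @^-1` [set r]) (w x)%:E).
  rewrite [X in _ * X]esum_mkcond -ge0_esumZl//.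
    apply: eq_esum => x _; rewrite EFinM indicE; congr (_ * _).
    by case: (_ \in _); rewrite ?mulr1 ?mulr0.
  by move=> x; case: ifPn => // _; rewrite lee_fin.
have hr r : r \in finmap.enum_fset (fset_set (range h)) -> (0 <= r)%R.
  move=> rh; have : r \in range h by rewrite -in_fset_set.
  by move=> /set_mem[x _ <-].
rewrite big_seq (eq_bigr _ (fun r rh => aE r (hr r rh))) -esum_sum; last first.
  by move=> x r _ /hr r0; rewrite lee_fin mulr_ge0// mulr_ge0.
apply: eq_esum => x _; rewrite -big_seq sumEFin fimfunE fsbig_finite// mulr_sumr.
by congr EFin; apply: eq_bigr => r _; rewrite mulrCA.
Qed.

Lemma integral_atomic (g : T -> R) : measurable_fun setT g ->
  (forall x, (0 <= g x)%R) ->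
  \int[mu]_x (g x)%:E = \esum_(x in [set: T]) (w x * g x)%:E.
Proof.
move=> mg g0; have mEg : measurable_fun setT (EFin \o g) by exact/measurable_EFinP.
pose h n : {nnsfun T >-> R} := nnsfun_approx measurableT mEg n.
have hg x : (h n x)%:E @[n --> \oo] --> (g x)%:E.
  by apply: cvg_nnsfun_approx => // y _; rewrite lee_fin.
have h_nd x : {homo (fun n => h n x) : m n / (m <= n)%N >-> (m <= n)%R}.
  by move=> m n mn; exact/lefP/nd_nnsfun_approx.
have h_le n x : (h n x <= g x)%R.
  have -> : g x = lim (h m x @[m --> \oo]).
    by apply/esym/cvg_lim => //; exact: fine_cvg (hg x).
  apply: nondecreasing_cvgn_le; first exact: h_nd.
  by apply/cvg_ex; exists (g x); apply: fine_cvg (hg x).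
have ghE : \int[mu]_x (g x)%:E = limn (fun n => \int[mu]_x (h n x)%:E).
  rewrite -monotone_convergence//.
  - by apply: eq_integral => x _; apply/esym/cvg_lim => //; exact: hg.
  - by move=> n; exact/measurable_EFinP.
  - by move=> n x _; rewrite lee_fin.
  - by move=> x _ m n mn; rewrite lee_fin h_nd.
have nd_int : {homo (fun n => \int[mu]_x (h n x)%:E) : m n / (m <= n)%N >-> m <= n}.
  move=> m n mn; apply: ge0_le_integral => //.
  - by move=> x _; rewrite lee_fin.
  - exact/measurable_EFinP.
  - exact/measurable_EFinP.
  - by move=> x _; rewrite lee_fin h_nd.
have cvg_int := ereal_nondecreasing_cvgn nd_int.
apply/eqP; rewrite eq_le ghE (cvg_lim _ cvg_int)//; apply/andP; split.
  apply: ge_ereal_sup => _ [n _ <-]; rewrite integral_atomic_nnsfun.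
  by apply: le_esum => x _; rewrite lee_fin ler_wpM2l.
(* Conversely, a finite partial sum for [g] is the limit of the partial sums for [h n], each at most
   the integral of [h n]. *)
apply: ge_ereal_sup => _ [A [fA _] <-].
rewrite fsbig_finite//.
have cvgEA : \sum_(x <- finmap.enum_fset (fset_set A)) (w x * h n x)%:E @[n --> \oo] -->
    \sum_(x <- finmap.enum_fset (fset_set A)) (w x * g x)%:E.
  apply: cvg_nnesum => x _; first by apply: nearW => n; rewrite lee_fin mulr_ge0.
  apply: cvg_EFin; first exact: nearW.
  by apply: cvgMl_tmp; exact: fine_cvg (hg x).
rewrite -(cvg_lim _ cvgEA)// -(cvg_lim _ cvg_int)//.
apply: lee_lim; [by apply/cvg_ex; eexists; exact: cvgEA| |].
  by apply/cvg_ex; eexists; exact: cvg_int.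
apply: nearW => n; rewrite integral_atomic_nnsfun; apply: esum_ge.
by exists A => //; rewrite fsbig_finite.
Qed.

End atomic_integral.

Section mixture.
Import HBNNSimple.
Context d1 d2 (X : measurableType d1) (Y : measurableType d2) (R : realType).
Variables (P : {measure set X -> \bar R}) (k : X -> {measure set Y -> \bar R}).
Variable Q : {measure set Y -> \bar R}.
Hypothesis mk : forall U, measurable U -> measurable_fun setT (k ^~ U).
Hypothesis QE : forall U, measurable U -> Q U = (\int[P]_x k x U)%E.
Local Open Scope ereal_scope.

Let integral_mixture_nnsfun (h : {nnsfun Y >-> R}) :
  \int[Q]_y (h y)%:E = \int[P]_x \int[k x]_y (h y)%:E.
Proof.
rewrite integralT_nnsfun sintegralE.
transitivity (\int[P]_x \sum_(r \in range h) (r%:E * k x (h @^-1` [set r]))).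
  rewrite ge0_integral_fsum//.
  - apply: eq_fsbigr => r /set_mem[y _ <-].
    by rewrite QE// ge0_integralZl// ?lee_fin//; exact: mk.
  - by move=> r; apply: measurable_funeM; exact: mk.
  - by move=> r x _; exact: nnsfun_mulemu_ge0.
by apply: eq_integral => x _; rewrite integralT_nnsfun sintegralE.
Qed.

(** [QE] settles indicators, linearity simple functions, and monotone convergence, used for [Q], for
    each [k x] and for [P], the general case. *)
Lemma integral_mixture (g : Y -> \bar R) : measurable_fun setT g ->
  (forall y, 0 <= g y) -> \int[Q]_y g y = \int[P]_x \int[k x]_y g y.
Proof.
move=> mg g0; pose h n : {nnsfun Y >-> R} := nnsfun_approx measurableT mg n.
have mh n : measurable_fun setT (EFin \o h n) by exact/measurable_EFinP.
have gE (mu : {measure set Y -> \bar R}) :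
    \int[mu]_y g y = limn (fun n => \int[mu]_y (h n y)%:E).
  rewrite -monotone_convergence//.
  - by apply: eq_integral => y _; apply/esym/cvg_lim => //; exact: cvg_nnsfun_approx.
  - by move=> n y _; rewrite lee_fin.
  - by move=> y _ m n mn; rewrite lee_fin; exact/lefP/nd_nnsfun_approx.
rewrite gE; under eq_fun do rewrite integral_mixture_nnsfun.
under [RHS]eq_integral do rewrite gE.
rewrite monotone_convergence//.
- move=> n; apply: measurable_fun_integral_kernel => //; last exact: mh.
  by move=> y; rewrite lee_fin.
- by move=> n x _; apply: integral_ge0 => y _; rewrite lee_fin.
- move=> x _ m n mn; apply: ge0_le_integral => //; try exact: mh.
  + by move=> y _; rewrite lee_fin.
  + by move=> y _; rewrite lee_fin; exact/lefP/nd_nnsfun_approx.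
Qed.

End mixture.

(** * Campbell's formula *)

Section configuration_measurability.
Context {R : realType} {E : completeMetricType R}.
Hypothesis E_bounded_precompact : bounded_precompact E.
Local Open Scope ereal_scope.

Lemma conf_measure_bounded (X : Conf E) (B : set E) : mbounded B ->
  conf_measure X B < +oo.
Proof.
move=> bB; rewrite -[conf_measure X B]/(\esum_(x in B) ((X x)%:R)%:E).
pose S := [set x | X x != 0%N].
have -> : \esum_(x in B) ((X x)%:R)%:E = \esum_(x in B `&` S) ((X x)%:R)%:E :> \bar R.
  rewrite esum_mkcondr; apply: eq_esum => x _; case: ifPn => //.
  by rewrite notin_setE/= => /negP/negPn/eqP ->.
have fS : finite_set (B `&` S) by exact: mult_finite.
rewrite (esum_fset fS); last by move=> x _; rewrite lee_fin.
by rewrite fsbig_finite// sumEFin ltry.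
Qed.

Lemma conf_eval_continuous (phi : E -> R) : continuous phi ->
  compact (closure [set x | phi x != 0%R]) ->
  continuous (fun X : Conf E => (\int[conf_measure X]_x (phi x))%R).
Proof.
move=> cphi kphi; pose p : compactly_supported E := exist _ phi (conj cphi kphi).
move=> X; apply: (@continuous_comp _ _ _ (@vague_eval R E) (@proj _ (fun=> R) p)).
  exact: initial_continuous.
exact: proj_continuous.
Qed.

(** The tents of a bounded [U] have compact support, so their integrals are vaguely continuous in
    the configuration; the count in [U] is their pointwise limit. *)
Lemma measurable_conf_open (U : set E) : open U -> mbounded U ->
  measurable_fun setT (fun X : borel (Conf E) => conf_measure X U).
Proof.
move=> oU bU; pose ev n (X : Conf E) := (\int[conf_measure X]_x (tent U n x))%R.
apply: (@emeasurable_fun_cvg _ (borel (Conf E)) _ _ (fun n X => (ev n X)%:E)).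
  move=> n; apply/measurable_EFinP; apply: continuous_borel.
  apply: conf_eval_continuous; first exact: tent_continuous.
  apply: E_bounded_precompact; have [x [r Ur]] := bU; exists x, r => y /= ty.
  by apply: Ur; apply: contrapT => /(tent_out n)/eqP; rewrite (negbTE ty).
move=> X _.
rewrite (_ : (fun n => _) = fun n => \int[conf_measure X]_x (tent U n x)%:E).
  exact: cvg_integral_tent.
apply/funext => n; rewrite /ev fineK// ge0_fin_numE; last first.
  by apply: integral_ge0 => x _; rewrite lee_fin tent_ge0.
apply: le_lt_trans (integral_tent_le _ n oU) _.
exact: conf_measure_bounded.
Qed.

(** Dynkin's argument starting from open sets: the bounded window [W] keeps the counts finite, so
    that passing to complements is a subtraction. *)
Lemma measurable_conf_bounded (W : set E) (A : set (borel E)) :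
  open W -> mbounded W -> measurable A ->
  measurable_fun setT (fun X : borel (Conf E) => conf_measure X (A `&` W)).
Proof.
move=> oW bW; move: A; have mW := open_borel oW.
apply: (@dynkin_induction _ (borel E) (@open E)
  (fun A => measurable_fun setT
    (fun X : borel (Conf E) => conf_measure X (A `&` W)))) => //.
- exact: openI.
- by rewrite setTI; exact: measurable_conf_open.
- move=> U oU; apply: measurable_conf_open; first exact: openI.
  by have [x [r Wr]] := bW; exists x, r => y [_ /Wr].
- move=> A mA mXA.
  rewrite (_ : (fun X : borel (Conf E) => _) =
      fun X : borel (Conf E) => conf_measure X W - conf_measure X (A `&` W)).
    by apply: emeasurable_funB => //; exact: measurable_conf_open.
  apply/funext => X; rewrite setIC -setDE measureD//; first by rewrite setIC.
  exact: conf_measure_bounded.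
- move=> F mF tF mXF.
  rewrite (_ : (fun X : borel (Conf E) => _) =
      fun X : borel (Conf E) => \sum_(n <oo) conf_measure X (F n `&` W)).
    exact: ge0_emeasurable_sum.
  apply/funext => X; rewrite setI_bigcupl measure_bigcup//.
  + by apply: eq_eseriesl => n; rewrite in_setT.
  + by move=> n _; exact: measurableI.
  + exact: trivIset_setIr.
Qed.

(** Balls of integer radius about [point] exhaust the space, and the counts in these windows
    increase to the count in [A]. *)
Lemma measurable_conf_measure (A : set (borel E)) : measurable A ->
  measurable_fun setT (fun X : borel (Conf E) => conf_measure X A).
Proof.
move=> mA; pose W n : set E := ball point (n%:R : R).
have oW n : open (W n) by exact: metric_ball_open.
have AE : \bigcup_n (A `&` W n) = A.
  rewrite -setI_bigcupr (_ : \bigcup_n W n = setT) ?setIT//.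
  apply/seteqP; split => // x _.
  have [n xn] := filter_ex (nbhs_infty_gtr (mdist point x)).
  by exists n => //; rewrite /W ballEmdist.
apply: (@emeasurable_fun_cvg _ (borel (Conf E)) _ _
  (fun n X => conf_measure X (A `&` W n))).
  by move=> n; apply: measurable_conf_bounded => //; exists point, n%:R.
move=> X _; rewrite -[in X in _ --> X]AE.
apply: (@nondecreasing_cvg_mu _ (borel E) _ (conf_measure X) (fun n => A `&` W n)).
- by move=> n; apply: measurableI => //; exact: open_borel.
- apply: bigcup_measurable => n _; apply: measurableI => //; exact: open_borel.
- move=> m n mn; apply/subsetPset; apply: setIS; apply: le_ball.
  by rewrite ler_nat.
Qed.

Variable P : probability (borel (Conf E)) R.

(** The intensity is the mixture under [P] of the counting measures [conf_measure X], so
    [integral_mixture] applies once the intensity is shown to be a measure. *)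
Lemma campbell (A : set (borel E)) (g : borel E -> \bar R) : measurable A ->
  measurable_fun A g -> (forall x, A x -> 0 <= g x) ->
  \int[intensity P]_(x in A) g x = \int[P]_X \int[conf_measure X]_(x in A) g x.
Proof.
move=> mA mg g0.
have m0 : intensity P set0 = 0 by apply: integral0_eq => X _; exact: measure0.
have m_ge0 B : 0 <= intensity P B by exact: integral_ge0.
have m_sigma : semi_sigma_additive (intensity P).
  move=> F mF tF mUF; rewrite /intensity.
  rewrite (_ : \int[P]_X _ = \sum_(n <oo) intensity P (F n)); last first.
    rewrite -integral_nneseries//; last by move=> n; exact: measurable_conf_measure.
    apply: eq_integral => X _; rewrite measure_bigcup//.
    by apply: eq_eseriesl => n; rewrite in_setT.
  by apply: is_cvg_nneseries => n _ _; exact: m_ge0.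
pose Qm := isMeasure.Build _ _ _ (intensity P) m0 m_ge0 m_sigma.
pose Q : {measure set (borel E) -> \bar R} := HB.pack (intensity P) Qm.
rewrite -[LHS]/(\int[Q]_(x in A) g x) integral_mkcond.
under [RHS]eq_integral do rewrite integral_mkcond.
apply: (@integral_mixture _ _ _ _ _ P (@conf_measure R E)) => //.
- by move=> B; exact: measurable_conf_measure.
- exact/(measurable_restrictT _ mA).
- by move=> x; rewrite patchE; case: ifPn => // /set_mem/g0.
Qed.

End configuration_measurability.

(** * The map sigma_f *)

Lemma lty_real_bound {R : realType} (x : \bar R) : (x < +oo)%E ->
  exists2 M : R, 0 < M & (x <= M%:E)%E.
Proof.
case: x => [r _|//|_]; last by exists 1; rewrite ?leNye.
by exists (`|r| + 1); rewrite ?ltr_wpDl// lee_fin (le_trans (ler_norm r))// lerDl.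
Qed.

Section sigma_map_measurability.
Context {R : realType} {E : completeMetricType R}.
Variable f : E -> R.
Hypothesis f_ge0 : forall x, 0 <= f x.
Hypothesis f_continuous : continuous f.
Local Open Scope ereal_scope.

(** On [Conf_f f] this is the mass that [sigma_map] gives to [A]; as an integral it makes sense for
    every configuration, with value [+oo] allowed. *)
Definition conf_integral (A : set (borel E)) (X : Conf E) : \bar R :=
  \int[conf_measure X]_x (f x * \1_A x)%:E.

Lemma f_indic_borel (A : set (borel E)) : measurable A ->
  measurable_fun setT (fun x : borel E => f x * \1_A x)%R.
Proof.
move=> mA; apply: measurable_funM; first exact: continuous_borel.
exact: measurable_indic.
Qed.

Lemma f_indic_ge0 (A : set (borel E)) x : (0 <= f x * \1_A x :> R)%R.
Proof. by rewrite mulr_ge0. Qed.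

Lemma conf_integral_ge0 A X : 0 <= conf_integral A X.
Proof. by apply: integral_ge0 => x _; rewrite lee_fin f_indic_ge0. Qed.

Lemma conf_integralE (A : set (borel E)) (X : Conf E) : measurable A ->
  conf_integral A X = \esum_(x in A) ((X x)%:R * f x)%:E.
Proof.
move=> mA; rewrite esum_mkcond /conf_integral /conf_measure integral_atomic.
- apply: eq_esum => x _; rewrite indicE.
  by case: (x \in A); rewrite ?mulr1 ?mulr0.
- exact: f_indic_borel.
- by move=> x; exact: f_indic_ge0.
Qed.

Lemma Conf_fE : Conf_f f = [set X | conf_integral setT X < +oo].
Proof. by apply/seteqP; split => X /=; rewrite conf_integralE. Qed.

Lemma sigma_mapE (X : Conf E) (A : set (borel E)) : measurable A -> Conf_f f X ->
  sigma_map f_ge0 X A = conf_integral A X.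
Proof.
move=> mA Xf; rewrite /sigma_map; case: pselect => // Xf'.
by rewrite mfin_ofE// conf_integralE.
Qed.

Hypothesis E_bounded_precompact : bounded_precompact E.

Lemma measurable_conf_integral A : measurable A ->
  measurable_fun setT (conf_integral A : borel (Conf E) -> \bar R).
Proof.
move=> mA; apply: measurable_fun_integral_kernel.
- exact: measurable_conf_measure.
- by move=> x; rewrite lee_fin f_indic_ge0.
- by apply/measurable_EFinP; exact: f_indic_borel.
Qed.

Lemma measurable_Conf_f : measurable (Conf_f f : set (borel (Conf E))).
Proof.
rewrite Conf_fE -[X in measurable X]setTI.
exact: emeasurable_fun_infty_o (measurable_conf_integral measurableT) _.
Qed.

Lemma measurable_sigma_map : separable E ->
  measurable_fun (Conf_f f : set (borel (Conf E)))
    (sigma_map f_ge0 : borel (Conf E) -> borel (Mfin R E)).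
Proof.
move=> sE; apply: measurable_fun_mfin => //; first exact: measurable_Conf_f.
move=> U oU; have mU := open_borel oU.
apply: (eq_measurable_fun (conf_integral U : borel (Conf E) -> \bar R)).
  by move=> X /set_mem Xf; rewrite sigma_mapE.
by apply: measurable_funTS; exact: measurable_conf_integral.
Qed.

Section one_law.
Variable P : probability (borel (Conf E)) R.

Lemma expectation_conf_integral (A : set (borel E)) : measurable A ->
  \int[P]_X conf_integral A X = \int[intensity P]_(x in A) (f x)%:E.
Proof.
move=> mA; rewrite campbell//.
- apply: eq_integral => X _; rewrite integral_mkcond; apply: eq_integral => x _.
  by rewrite patchE indicE; case: (x \in A); rewrite ?mulr1 ?mulr0.
- by apply: measurable_funTS; apply/measurable_EFinP; exact: continuous_borel.
- by move=> x _; rewrite lee_fin.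
Qed.

Lemma conf_integral_markov (A : set (borel E)) (c m : R) : measurable A ->
  (0 < c)%R -> \int[intensity P]_(x in A) (f x)%:E <= m%:E ->
  P [set X | c%:E < conf_integral A X] <= (m / c)%:E.
Proof.
move=> mA c0 fm; have mI := measurable_conf_integral mA.
rewrite EFinM lee_pdivlMr// muleC.
apply: le_trans fm; rewrite -expectation_conf_integral//.
under eq_integral do rewrite -[conf_integral A _]gee0_abs ?conf_integral_ge0//.
apply: le_trans (le_integral_abse P measurableT mI c0).
apply: lee_wpmul2l; first by rewrite lee_fin ltW.
apply: le_measure.
- apply: mem_set; rewrite -[X in measurable X]setTI.
  exact: emeasurable_fun_o_infty.
- by apply: mem_set; apply: emeasurable_fun_c_infty => //; exact: measurableT_comp.
- by move=> X /= /ltW cX; split => //; rewrite gee0_abs ?conf_integral_ge0.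
Qed.

Hypothesis f_fin : \int[intensity P]_x (f x)%:E < +oo.

(** [Conf_f f] is the event that [conf_integral setT] is finite; its expectation is finite by
    Campbell's formula, so it is finite almost surely. *)
Lemma probability_Conf_f : P (Conf_f f) = 1.
Proof.
have iI : P.-integrable setT (conf_integral setT).
  apply/integrableP; split; first exact: measurable_conf_integral.
  under eq_integral do rewrite gee0_abs ?conf_integral_ge0//.
  by rewrite expectation_conf_integral.
have [N [mN PN0 NP]] := integrable_ae measurableT iI.
suff : P (~` Conf_f f) = 0.
  rewrite probability_setC//; last exact: measurable_Conf_f.
  have PD : P (Conf_f f) \is a fin_num.
    by apply: fin_num_measure; exact: measurable_Conf_f.
  by move/eqP; rewrite sube_eq ?fin_num_adde_defl// add0e => /eqP/esym.
apply: (subset_measure0 _ mN _ PN0).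
  by apply: measurableC; exact: measurable_Conf_f.
move=> X; rewrite Conf_fE /= => XI; apply: NP => /= /(_ I).
by rewrite ge0_fin_numE ?conf_integral_ge0.
Qed.

Lemma sigma_map_pushforward : separable E ->
  exists Q : Mfin R (Mfin R E), is_pushforward P (Conf_f f) (sigma_map f_ge0) Q.
Proof.
move=> sE; pose g : borel (Conf E) -> borel (Mfin R E) := sigma_map f_ge0.
have mg : measurable_fun (Conf_f f : set (borel (Conf E))) g.
  exact: measurable_sigma_map.
have mD := measurable_Conf_f.
(* Intersecting with [Conf_f f] discards the default value [mfin0] taken elsewhere, and loses no
   mass since [Conf_f f] has probability 1. *)
pose q (A : set (borel (Mfin R E))) := P (Conf_f f `&` g @^-1` A).
have q0 : q set0 = 0 by rewrite /q preimage_set0 setI0.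
have q_ge0 A : 0 <= q A by exact: measure_ge0.
have q_sigma : semi_sigma_additive q.
  move=> F mF tF mUF; rewrite /q preimage_bigcup setI_bigcupr.
  apply: measure_semi_sigma_additive.
  - by move=> n; exact: mg.
  - apply/trivIsetP => i j _ _ ij; rewrite setIACA setIid -preimage_setI.
    by move/trivIsetP : tF => /(_ _ _ I I ij) ->; rewrite preimage_set0 setI0.
  - by rewrite -setI_bigcupr -preimage_bigcup; exact: mg.
pose qm := isMeasure.Build _ _ _ q q0 q_ge0 q_sigma.
pose Q : {measure set (borel (Mfin R E)) -> \bar R} := HB.pack q qm.
have QT : Q setT < +oo.
  by rewrite /Q/= /q preimage_setT setIT probability_Conf_f ltry.
exists (mfin_of QT); split => //; first exact: probability_Conf_f.
by move=> A mA; rewrite mfin_ofE.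
Qed.

End one_law.

End sigma_map_measurability.

(** * Tightness of the image laws *)

Unset Implicit Arguments.
Set Strict Implicit.
Set Printing Implicit Defensive.

Theorem proposition3p2 (R : realType) (E : completeMetricType R)
    (E_locally_compact : locally_compact [set: E])
    (E_separable : separable E)
    (E_bounded_precompact : bounded_precompact E)
    (f : E -> R) (f_ge0 : forall x, 0 <= f x) (f_continuous : continuous f)
    (I : Type) (P : I -> probability (borel (Conf E)) R)
    (f_L1 : forall i, (intensity (P i)).-integrable setT (EFin \o f))
    (f_bounded : (ereal_sup
       [set (\int[intensity (P i)]_x (f x)%:E)%E | i in [set: I]] < +oo)%E)
    (f_tight : forall e : R, 0 < e -> exists2 B : set E, compact B &
       (ereal_sup [set (\int[intensity (P i)]_(x in ~` B) (f x)%:E)%E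
                  | i in [set: I]] < e%:E)%E) :
  exists Q : I -> Mfin R (Mfin R E),
    (forall i, is_pushforward (P i) (Conf_f f) (sigma_map f_ge0) (Q i)) /\
    tight Q.

Proof.
have fB (B : set E) (r : R) : (ereal_sup
    [set (\int[intensity (P i)]_(x in B) (f x)%:E)%E | i in [set: I]] <= r%:E)%E ->
    forall i, (\int[intensity (P i)]_(x in B) (f x)%:E <= r%:E)%E.
  by move=> Br i; apply: le_trans Br; apply: ereal_sup_ubound; exists i.
have [M M0 /fB fM] := lty_real_bound f_bounded.
have f_fin i : (\int[intensity (P i)]_x (f x)%:E < +oo)%E.
  by apply: le_lt_trans (fM i) _; rewrite ltry.
have [Q QP] : {Q : I -> Mfin R (Mfin R E) &
    forall i, is_pushforward (P i) (Conf_f f) (sigma_map f_ge0) (Q i)}.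
  apply: (@choice _ _
    (fun i => is_pushforward (P i) (Conf_f f) (sigma_map f_ge0))) => i.
  exact: sigma_map_pushforward.
exists Q; split => //.
have QE i A : measurable A -> Q i A = P i (Conf_f f `&` sigma_map f_ge0 @^-1` A).
  by move=> mA; have [_ _ _ ->] := QP i.
split.
  apply: (@le_lt_trans _ _ 1%E); last exact: ltry.
  apply: ge_ereal_sup => _ [i _ <-]; rewrite QE// preimage_setT setIT.
  by have [_ -> _ _] := QP i.
move=> e e0.
have e40 : 0 < e / 4 by rewrite divr_gt0.
(* Markov's inequality at level [1 / (n + 1)] multiplies by [n + 1], which leaves
   [e / 4 / 2 ^ (n + 1)], a series with sum [e / 4]. *)
pose eps n : R := e / 4 / (2 ^ n.+1)%:R / n.+1%:R.
have eps0 n : 0 < eps n by rewrite !divr_gt0// ltr0n expn_gt0.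
have [B BP] : {B : nat -> set E & forall n, compact (B n) /\
    forall i, (\int[intensity (P i)]_(x in ~` B n) (f x)%:E <= (eps n)%:E)%E}.
  apply: (@choice _ _ (fun n B => compact B /\
    forall i, (\int[intensity (P i)]_(x in ~` B) (f x)%:E <= (eps n)%:E)%E)) => n.
  have [B cB /ltW/fB fBn] := f_tight (eps n) (eps0 n).
  by exists B.
have cB n : compact (B n) by have [] := BP n.
(* With this level Markov's inequality bounds the probability of a total mass above [C] by
   [M / C = e / 4]. *)
pose C : R := M / (e / 4).
have C0 : 0 < C by rewrite divr_gt0.
have cK := tight_ball_closed (C := C) cB.
exists (tight_ball C B); split => //; first exact: tight_ball_compact.
(* The bound [e / 2] for each [i] keeps the supremum strictly below [e]. *)
apply: (@le_lt_trans _ _ (e / 2)%:E); last by rewrite lte_fin; lra.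
apply: ge_ereal_sup => _ [i _ <-].
have mB n : measurable (~` B n : set (borel E)).
  by apply: open_borel; apply: closed_openC; exact: metric_compact_closed (@cB n).
have mK : measurable (~` tight_ball C B : set (borel (Mfin R E))).
  by apply: open_borel; exact: closed_openC.
rewrite QE//.
(* [far n] and [heavy] are the events that one condition of the ball fails; on [Conf_f f] the random
   measure leaves the ball only inside their union. *)
pose far n := [set X : borel (Conf E) |
  ((n.+1%:R^-1)%:E < conf_integral f (~` B n) X)%E].
pose heavy := [set X : borel (Conf E) | (C%:E < conf_integral f setT X)%E].
have mI A : measurable (A : set (borel E)) ->
  measurable_fun setT (conf_integral f A : borel (Conf E) -> \bar R).
  by move=> mA; exact: measurable_conf_integral.
have mfar n : measurable (far n).
  by rewrite -[far n]setTI; exact: emeasurable_fun_o_infty (mI _ (mB n)) _.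
have mheavy : measurable heavy.
  by rewrite -[heavy]setTI; exact: emeasurable_fun_o_infty (mI _ measurableT) _.
have markov :=
  @conf_integral_markov _ _ _ f_ge0 f_continuous E_bounded_precompact.
have mUfar : measurable (\bigcup_n far n) by exact: bigcup_measurable.
apply: (@le_trans _ _ (P i (heavy `|` \bigcup_n far n))).
  apply: le_measure.
  - by apply: mem_set; have [mD _ mg _] := QP i; exact: mg.
  - by apply: mem_set; exact: measurableU.
  - move=> X [Xf /= nK]; apply: contrapT => /not_orP[nheavy nfar]; apply: nK; split.
    + by rewrite sigma_mapE// leNgt; apply/negP.
    + move=> n; rewrite sigma_mapE// leNgt; apply/negP => Xn.
      by apply: nfar; exists n.
apply: (le_trans (measureU2 _ mheavy mUfar)).
rewrite (_ : e / 2 = e / 4 + e / 4); last by lra.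
rewrite EFinD; apply: leeD.
  apply: le_trans (markov _ _ _ _ measurableT C0 (fM i)) _.
  by rewrite lee_fin /C invf_div mulrCA mulfV ?mulr1// gt_eqF.
apply: le_trans (measure_sigma_subadditive _ mfar mUfar (fun _ => id)) _.
apply: le_trans (epsilon_trick0 xpredT (ltW e40)).
apply: lee_nneseries => // n *.
have n0 : 0 < n.+1%:R^-1 :> R by rewrite invr_gt0.
have [_ /(_ i) fBn] := BP n.
apply: le_trans (markov _ _ _ _ (mB n) n0 fBn) _.
by rewrite lee_fin /eps invrK divfK.
Qed.
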